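(* Let $k$ be a field and let $T$ be a totally ordered set. Every injective object in $\operatorname{Mod} kT$ is isomorphic to the injective envelope of a direct sum of indecomposable injective objects. Equivalently, the spectral category of $\operatorname{Mod} kT$ is discrete.
   Context: $\operatorname{Mod} kT$ is the category of functors from $T$ (viewed as a category with a unique morphism $x\to y$ whenever $x\le y$) to $k$-vector spaces; it is a Grothendieck category. The spectral category of a Grothendieck category $\mathcal A$ is the category obtained by localising $\mathcal A$ at the class of its essential monomorphisms. Every object of a spectral category decomposes as the sum of a semisimple object (its discrete part) and an object without simple subobjects (its continuous part); the spectral category is called discrete if the continuous part of every object is zero, i.e. every object is semisimple. *)

(* Defs.v *)
From Corelib Require Import RelationClasses Morphisms Setoid.
From mathcomp Require Import all_boot all_order all_algebra.

Set Implicit Arguments.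
Unset Strict Implicit.
Unset Printing Implicit Defensive.

(* Hom-sets carry an explicit equality [heq] (hom-setoids), so that functor
   categories need no functional extensionality and a localisation needs no
   quotient type. *)
Record category := Category {
  obj :> Type;
  mor : obj -> obj -> Type;
  heq : forall a b : obj, mor a b -> mor a b -> Prop;
  idm : forall a : obj, mor a a;
  compm : forall a b c : obj, mor b c -> mor a b -> mor a c;
  heq_equiv : forall a b : obj, Equivalence (@heq a b);
  compm_heq : forall (a b c : obj) (g g' : mor b c) (f f' : mor a b),
    heq g g' -> heq f f' -> heq (compm g f) (compm g' f');
  compm_idl : forall (a b : obj) (f : mor a b), heq (compm (idm b) f) f;
  compm_idr : forall (a b : obj) (f : mor a b), heq (compm f (idm a)) f;
  compm_assoc : forall (a b c d : obj)
      (h : mor c d) (g : mor b c) (f : mor a b),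
    heq (compm h (compm g f)) (compm (compm h g) f)
}.

Arguments mor {_} a b.
Arguments heq {_ a b} f g.
Arguments idm {_} a.
Arguments compm {_ a b c} g f.

#[export] Existing Instance heq_equiv.

#[local] Obligation Tactic := idtac.

Declare Scope cat_scope.
Delimit Scope cat_scope with cat.
Notation "f ≡ g" := (heq f g) (at level 70, no associativity) : cat_scope.
Notation "g ∘ f" := (compm g f) (at level 40, left associativity) : cat_scope.
Local Open Scope cat_scope.

#[export] Instance compm_proper (C : category) (a b c : C) :
  Proper (heq ==> heq ==> heq) (@compm C a b c).
Proof. by move=> g g' eg f f' ef; apply: compm_heq. Qed.

Definition is_iso (C : category) (a b : C) (f : mor a b) : Prop :=
  exists g : mor b a, g ∘ f ≡ idm a /\ f ∘ g ≡ idm b.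

Definition isomorphic (C : category) (a b : C) : Prop :=
  exists f : mor a b, is_iso f.

Definition is_mono (C : category) (a b : C) (f : mor a b) : Prop :=
  forall (x : C) (u v : mor x a), f ∘ u ≡ f ∘ v -> u ≡ v.

Definition is_zero (C : category) (z : C) : Prop :=
  (forall x : C, exists f : mor z x, forall g : mor z x, g ≡ f) /\
  (forall x : C, exists f : mor x z, forall g : mor x z, g ≡ f).

Definition is_coproduct (C : category) (I : Type) (F : I -> C) (S : C)
    (inj : forall i : I, mor (F i) S) : Prop :=
  forall (x : C) (f : forall i : I, mor (F i) x),
    exists h : mor S x, (forall i : I, h ∘ inj i ≡ f i) /\
      (forall h' : mor S x, (forall i : I, h' ∘ inj i ≡ f i) -> h' ≡ h).

Definition is_simple (C : category) (x : C) : Prop :=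
  ~ is_zero x /\
  forall (y : C) (m : mor y x), is_mono m -> is_zero y \/ is_iso m.

Definition is_semisimple (C : category) (x : C) : Prop :=
  exists (I : Type) (F : I -> C) (inj : forall i : I, mor (F i) x),
    (forall i : I, is_simple (F i)) /\ is_coproduct inj.

Definition is_indecomposable (C : category) (x : C) : Prop :=
  ~ is_zero x /\
  forall (F : bool -> C) (inj : forall b : bool, mor (F b) x),
    is_coproduct inj -> is_zero (F true) \/ is_zero (F false).

Definition is_injective (C : category) (e : C) : Prop :=
  forall (a b : C) (m : mor a b) (f : mor a e), is_mono m ->
    exists g : mor b e, g ∘ m ≡ f.

Definition is_essential_mono (C : category) (a b : C) (m : mor a b) : Prop :=
  is_mono m /\
  forall (c : C) (g : mor b c), is_mono (g ∘ m) -> is_mono g.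

Definition is_injective_envelope (C : category) (x e : C) (m : mor x e) :
    Prop :=
  is_essential_mono m /\ is_injective e.

Record functor (C D : category) := Functor {
  fobj :> C -> D;
  fmap : forall a b : C, mor a b -> mor (fobj a) (fobj b);
  fmap_heq : forall (a b : C) (f g : mor a b), f ≡ g -> fmap f ≡ fmap g;
  fmap_id : forall a : C, fmap (idm a) ≡ idm (fobj a);
  fmap_comp : forall (a b c : C) (g : mor b c) (f : mor a b),
    fmap (g ∘ f) ≡ fmap g ∘ fmap f
}.

Record nattrans (C D : category) (F G : functor C D) := NatTrans {
  ntr :> forall a : C, mor (F a) (G a);
  ntr_nat : forall (a b : C) (f : mor a b),
    ntr b ∘ fmap F f ≡ fmap G f ∘ ntr a
}.

Section FunctorCategory.
Variables C D : category.
Implicit Types F G H : functor C D.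

Definition nattrans_heq F G (s t : nattrans F G) : Prop :=
  forall a : C, s a ≡ t a.

Program Definition nattrans_id F : nattrans F F :=
  @NatTrans C D F F (fun a => idm (F a)) _.
Next Obligation.
move=> F a b f; rewrite compm_idl compm_idr; reflexivity.
Qed.

Program Definition nattrans_comp F G H (t : nattrans G H) (s : nattrans F G) :
    nattrans F H :=
  @NatTrans C D F H (fun a => t a ∘ s a) _.
Next Obligation.
move=> F G H t s a b f.
rewrite -compm_assoc ntr_nat compm_assoc ntr_nat compm_assoc; reflexivity.
Qed.

Program Definition functor_category : category :=
  @Category (functor C D) (@nattrans C D) nattrans_heq nattrans_id
    nattrans_comp _ _ _ _ _.
Next Obligation.
move=> F G; split=> [s a|s t e a|s t u e1 e2 a]; first reflexivity.
  by symmetry.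
by transitivity (t a).
Qed.
Next Obligation. by move=> F G H t t' s s' et es a; apply: compm_heq. Qed.
Next Obligation. by move=> F G s a; apply: compm_idl. Qed.
Next Obligation. by move=> F G s a; apply: compm_idr. Qed.
Next Obligation. by move=> F G H K u t s a; apply: compm_assoc. Qed.

End FunctorCategory.

Program Definition order_category (d : Order.disp_t) (T : porderType d) :
    category :=
  @Category T (fun x y => (x <= y)%O) (fun _ _ _ _ => True)
    (fun x => Order.POrderTheory.lexx x)
    (fun x y z hyz hxy => Order.POrderTheory.le_trans hxy hyz) _ _ _ _ _.
Next Obligation. by []. Qed.
Next Obligation. by []. Qed.
Next Obligation. by []. Qed.
Next Obligation. by []. Qed.
Next Obligation. by []. Qed.

Program Definition vect_category (k : fieldType) : category :=
  @Category (lmodType k) (fun U V => {linear U -> V}%R) (fun U V f g => f =1 g)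
    (fun U => idfun) (fun U V W g f => (g \o f)%FUN) _ _ _ _ _.
Next Obligation.
move=> k U V; split=> [f v|f g e v|f g h e1 e2 v] //.
by rewrite e1.
Qed.
Next Obligation. by move=> k U V W g g' f f' eg ef v /=; rewrite ef eg. Qed.
Next Obligation. by []. Qed.
Next Obligation. by []. Qed.
Next Obligation. by []. Qed.

Definition Mod (k : fieldType) (d : Order.disp_t) (T : orderType d) :
    category :=
  functor_category (order_category T) (vect_category k).

(* Gabriel-Zisman localisation C[W^-1]: same objects, morphisms freely generated
   by those of C and formal inverses of the members of W, modulo the least
   congruence making the result a category, C -> C[W^-1] a functor and the
   formal inverses inverses. *)
Section Localisation.
Variables (C : category) (W : forall a b : C, mor a b -> Prop).

Inductive loc_mor : C -> C -> Type :=
| loc_of (a b : C) (f : mor a b) : loc_mor a b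
| loc_inv (a b : C) (s : mor a b) (Ws : W s) : loc_mor b a
| loc_comp (a b c : C) (g : loc_mor b c) (f : loc_mor a b) : loc_mor a c.

Inductive loc_heq : forall a b : C, loc_mor a b -> loc_mor a b -> Prop :=
| loc_refl (a b : C) (f : loc_mor a b) : loc_heq f f
| loc_sym (a b : C) (f g : loc_mor a b) : loc_heq f g -> loc_heq g f
| loc_trans (a b : C) (f g h : loc_mor a b) :
    loc_heq f g -> loc_heq g h -> loc_heq f h
| loc_comp_heq (a b c : C) (g g' : loc_mor b c) (f f' : loc_mor a b) :
    loc_heq g g' -> loc_heq f f' -> loc_heq (loc_comp g f) (loc_comp g' f')
| loc_comp_idl (a b : C) (f : loc_mor a b) :
    loc_heq (loc_comp (loc_of (idm b)) f) f
| loc_comp_idr (a b : C) (f : loc_mor a b) :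
    loc_heq (loc_comp f (loc_of (idm a))) f
| loc_comp_assoc (a b c d : C)
    (h : loc_mor c d) (g : loc_mor b c) (f : loc_mor a b) :
    loc_heq (loc_comp h (loc_comp g f)) (loc_comp (loc_comp h g) f)
| loc_of_heq (a b : C) (f g : mor a b) :
    f ≡ g -> loc_heq (loc_of f) (loc_of g)
| loc_of_comp (a b c : C) (g : mor b c) (f : mor a b) :
    loc_heq (loc_of (g ∘ f)) (loc_comp (loc_of g) (loc_of f))
| loc_invl (a b : C) (s : mor a b) (Ws : W s) :
    loc_heq (loc_comp (loc_inv Ws) (loc_of s)) (loc_of (idm a))
| loc_invr (a b : C) (s : mor a b) (Ws : W s) :
    loc_heq (loc_comp (loc_of s) (loc_inv Ws)) (loc_of (idm b)).

Definition localisation : category :=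
  @Category C loc_mor loc_heq (fun a => loc_of (idm a)) loc_comp
    (fun a b => @Build_Equivalence _ _
       (@loc_refl a b) (@loc_sym a b) (@loc_trans a b))
    loc_comp_heq loc_comp_idl loc_comp_idr loc_comp_assoc.

End Localisation.

Definition spectral_category (C : category) : category :=
  localisation (@is_essential_mono C).

Definition is_discrete (S : category) : Prop :=
  forall x : S, is_semisimple x.

(* Main.v *)
(* Since [T] is a chain, any two nonzero subobjects of an interval module meet,
   so the subobject generated by a nonzero element is uniform; by Zorn's lemma a
   maximal independent family of uniform subobjects of [X] has an essential sum.
   If [X] is injective, the subobject generated by [x] (the interval module of
   the support of [x]) extends inside [X] to the interval module of the
   down-closure of that support, which is injective.
   A morphism of the spectral category is a partial map with essential domain,
   two of them being equal when they agree on an essential subobject. There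
   uniform objects are simple, essential inclusions are invertible, and an
   independent family with essential sum is a coproduct. *)
Require Import Defs.
From mathcomp Require Import all_boot all_order all_algebra.
From HB Require Import structures.
From mathcomp Require Import boolp classical_sets.

Set Implicit Arguments.
Unset Strict Implicit.
Unset Printing Implicit Defensive.

Import Order.TTheory GRing.Theory.
Local Open Scope ring_scope.

(** * Vector spaces *)

Section LinearAlgebra.
Variable k : fieldType.
Implicit Types U V : lmodType k.

(** The localisation is syntactic: its morphisms are words and its equality is an inductive
    congruence, so distinct morphisms cannot be told apart by inspection. Each word is therefore
    interpreted as a linear relation, its [graph]; [loc_heq_agree] and [agree_loc_heq] show that the
    interpretation is sound and complete, after which questions about the spectral category become
    questions about elements. Linear relations also serve elsewhere: the extension problem behind
    injectivity, maps out of internal sums and inverses of spectral monomorphisms all start as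
    partial maps, and a relation needs no separate domain object.

    What makes a chain special is that two nonzero elements of an interval module can be compared at
    the larger of their indices, where the stalk is a line. Uniformity of interval modules and
    injectivity of down-set modules both rest on this comparison. *)

Definition linear_map U V (f : U -> V) (lf : linear f) : {linear U -> V} :=
  HB.pack f (GRing.isLinear.Build k U V *:%R f lf).

Definition subspace V (N : V -> Prop) :=
  N 0 /\ forall c u v, N u -> N v -> N (c *: u + v).

Section Subspace.
Variables (V : lmodType k) (N : V -> Prop) (sN : subspace N).

Lemma subspaceD u v : N u -> N v -> N (u + v).
Proof. by case: sN => _ N1 Nu Nv; rewrite -[u]scale1r; apply: N1. Qed.

Lemma subspaceZ c u : N u -> N (c *: u).
Proof. by case: sN => N0 N1 Nu; rewrite -[_ *: _]addr0; apply: N1. Qed.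

Lemma subspaceN u : N u -> N (- u).
Proof. by move=> Nu; rewrite -scaleN1r; apply: subspaceZ. Qed.

(** The proof is an argument of the predicate so that the closure structure can be attached to this
    term and then inferred. *)
Definition in_subspace of subspace N : {pred V} := fun v => `[<N v>].

Lemma in_subspaceP v : reflect (N v) (v \in in_subspace sN).
Proof. exact: asboolP. Qed.

Lemma in_subspace_closed : submod_closed (in_subspace sN).
Proof.
case: sN => N0 N1; split=> [|c u v /in_subspaceP Nu /in_subspaceP Nv].
  exact/in_subspaceP.
exact/in_subspaceP/N1.
Qed.

HB.instance Definition _ :=
  GRing.isSubmodClosed.Build k V (in_subspace sN) in_subspace_closed.

Record subspace_type :=
  SubspaceElt { sval_of :> V; _ : sval_of \in in_subspace sN }.

HB.instance Definition _ := [isSub for sval_of].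
HB.instance Definition _ := [Choice of subspace_type by <:].
HB.instance Definition _ := [SubChoice_isSubLmodule of subspace_type by <:].

Definition quotient_type := Quotient.quot (in_subspace sN).
HB.instance Definition _ := GRing.Zmodule.on quotient_type.

Definition quotient_pi (v : V) : quotient_type := \pi_(quotient_type)%qT v.
Definition quotient_repr (q : quotient_type) : V := repr q.

Lemma quotient_reprK : cancel quotient_repr quotient_pi.
Proof. exact: reprK. Qed.

Lemma quotient_piP u v : quotient_pi u = quotient_pi v <-> N (u - v).
Proof.
split=> [/eqP|/in_subspaceP].
  by rewrite -[_ == _]Quotient.idealrBE => /in_subspaceP.
by rewrite [_ \in _]Quotient.idealrBE => /eqP.
Qed.

Lemma quotient_piD : {morph quotient_pi : u v / u + v}.
Proof. by move=> u v; apply: raddfD. Qed.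

Definition quotient_scale c (q : quotient_type) :=
  quotient_pi (c *: quotient_repr q).

Lemma quotient_scaleE c v :
  quotient_scale c (quotient_pi v) = quotient_pi (c *: v).
Proof.
apply/quotient_piP; rewrite -scalerBr; apply: subspaceZ.
exact/quotient_piP/quotient_reprK.
Qed.

Lemma quotient_ind (P : quotient_type -> Prop) :
  (forall v, P (quotient_pi v)) -> forall q, P q.
Proof. by move=> IH q; rewrite -[q]quotient_reprK. Qed.

Fact quotient_scaleA a b q :
  quotient_scale a (quotient_scale b q) = quotient_scale (a * b) q.
Proof. by elim/quotient_ind: q => v; rewrite !quotient_scaleE scalerA. Qed.

Fact quotient_scale1 : left_id 1 quotient_scale.
Proof. by elim/quotient_ind=> v; rewrite quotient_scaleE scale1r. Qed.

Fact quotient_scaleDr : right_distributive quotient_scale +%R.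
Proof.
move=> a; elim/quotient_ind=> u; elim/quotient_ind=> v.
by rewrite -quotient_piD !quotient_scaleE scalerDr quotient_piD.
Qed.

Fact quotient_scaleDl q : {morph quotient_scale^~ q : a b / a + b}.
Proof.
elim/quotient_ind: q => v a b.
by rewrite !quotient_scaleE scalerDl quotient_piD.
Qed.

HB.instance Definition _ := GRing.Zmodule_isLmodule.Build k quotient_type
  quotient_scaleA quotient_scale1 quotient_scaleDr quotient_scaleDl.

Fact quotient_pi_linear : linear quotient_pi.
Proof. by move=> c u v; rewrite quotient_piD -quotient_scaleE. Qed.
HB.instance Definition _ :=
  GRing.isLinear.Build k V quotient_type *:%R quotient_pi quotient_pi_linear.

End Subspace.

Section InducedMaps.
Variables (V V' : lmodType k) (N : V -> Prop) (N' : V' -> Prop).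
Variables (sN : subspace N) (sN' : subspace N') (f : {linear V -> V'}).
Hypothesis fN : forall v, N v -> N' (f v).

Fact restrict_map_proof (v : subspace_type sN) : f (val v) \in in_subspace sN'.
Proof. by apply/in_subspaceP/fN/(in_subspaceP sN); case: v. Qed.

Definition restrict_map (v : subspace_type sN) : subspace_type sN' :=
  SubspaceElt (restrict_map_proof v).

Fact restrict_map_linear : linear restrict_map.
Proof. by move=> c u v; apply/val_inj; rewrite /= linearP. Qed.
HB.instance Definition _ := GRing.isLinear.Build k (subspace_type sN)
  (subspace_type sN') *:%R restrict_map restrict_map_linear.

Definition quotient_map (q : quotient_type sN) : quotient_type sN' :=
  quotient_pi sN' (f (quotient_repr q)).

Lemma quotient_mapE v : quotient_map (quotient_pi sN v) = quotient_pi sN' (f v).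
Proof.
apply/quotient_piP; rewrite -linearB; apply: fN.
exact/(quotient_piP sN)/quotient_reprK.
Qed.

Fact quotient_map_linear : linear quotient_map.
Proof.
move=> c; elim/quotient_ind=> u; elim/quotient_ind=> v.
by rewrite -linearP !quotient_mapE !linearP.
Qed.
HB.instance Definition _ := GRing.isLinear.Build k (quotient_type sN)
  (quotient_type sN') *:%R quotient_map quotient_map_linear.
End InducedMaps.

(* ['rV_b] is [k] or [0] according to the boolean [b]; [rVtr] is the identity of
   [k] or the zero map. *)
Definition rVtr (b c : bool) : {linear 'rV[k]_b -> 'rV[k]_c} :=
  mulmxr (const_mx 1 : 'M_(b, c)).

Lemma rVtr_id (b : bool) (v : 'rV_b) : rVtr b b v = v.
Proof.
case: b v => v; last by rewrite [v]thinmx0 linear0.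
rewrite /= (_ : const_mx 1 = 1%:M) ?mulmx1 //.
by apply/matrixP=> i j; rewrite !mxE !ord1.
Qed.

(** The hypothesis is convexity: it excludes [k -> 0 -> k], whose composite would be zero instead of
    the identity. *)
Lemma rVtr_comp (b c d : bool) (v : 'rV_b) :
  (b -> d -> c) -> rVtr c d (rVtr b c v) = rVtr b d v.
Proof.
case: b v => v; last by rewrite [v]thinmx0 !linear0.
case: d => [/(_ isT isT)->|_]; last by rewrite [LHS]thinmx0 [RHS]thinmx0.
exact: rVtr_id.
Qed.

Lemma rVtr_eq0 (b c : bool) (v : 'rV_b) : c -> rVtr b c v = 0 -> v = 0.
Proof.
case: b v => [|v _ _]; last exact: thinmx0.
by case: c => // v _; rewrite rVtr_id.
Qed.

Lemma rV_neq0 (b : bool) (v : 'rV[k]_b) : v <> 0 -> b.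
Proof. by case: b v => // v; rewrite [v]thinmx0. Qed.

Lemma const_mx1_neq0 (b : bool) : b -> (const_mx 1 : 'rV[k]_b) <> 0.
Proof.
by case: b => // _ /rowP/(_ 0); rewrite !mxE => /eqP; rewrite oner_eq0.
Qed.

Lemma rVtr_const (b c : bool) a : b -> rVtr b c (const_mx a) = const_mx a.
Proof.
case: b => // _; case: c; last by rewrite [LHS]thinmx0 [RHS]thinmx0.
exact: rVtr_id.
Qed.

Lemma rV_const (b : bool) (v : 'rV[k]_b) : exists a, v = const_mx a.
Proof.
case: b v => v; last by exists 0; rewrite [LHS]thinmx0 [RHS]thinmx0.
by exists (v 0 0); apply/rowP=> j; rewrite !mxE !ord1.
Qed.

End LinearAlgebra.
Arguments restrict_map {k V V' N N'} sN sN' {f} fN v.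
Arguments quotient_map {k V V' N N'} sN sN' f q.

(** * Elements, relations, subobjects and quotients *)

Section Representations.
Variables (k : fieldType) (d : Order.disp_t) (T : orderType d).
Local Notation Mod := (Mod k T).
Implicit Types (X Y Z : Mod) (s t u : T).

Definition stalk X s : lmodType k :=
  (X : functor (order_category T) (vect_category k)) s.

(* Total in both indices: zero unless [s <= t]. *)
Definition push X s t : {linear stalk X s -> stalk X t} :=
  match @idP (s <= t)%O with
  | ReflectT st =>
      @fmap _ _ (X : functor (order_category T) (vect_category k)) s t st
  | ReflectF _ => \0
  end.

Definition app X Y (f : mor X Y) s : {linear stalk X s -> stalk Y s} :=
  (f : nattrans _ _) s.

Lemma push_id X s x : push X s s x = x.
Proof.
rewrite /push; case: {-}_ / idP => [st|]; last by rewrite lexx.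
by rewrite (bool_irrelevance st (lexx s)); apply: (fmap_id X s).
Qed.

Lemma push_comp X s t u x : (s <= t)%O -> (t <= u)%O ->
  push X t u (push X s t x) = push X s u x.
Proof.
rewrite /push => st tu; case: {-}_ / idP => // tu'; case: {-}_ / idP => // st'.
case: {-}_ / idP => [su|[]]; last exact: le_trans tu.
rewrite (bool_irrelevance su (le_trans st' tu')); symmetry.
exact: (@fmap_comp _ _ X s t u tu' st').
Qed.

Lemma push_nle X s t x : ~~ (s <= t)%O -> push X s t x = 0.
Proof. by rewrite /push => /negP st; case: {-}_ / idP. Qed.

Lemma app_push X Y (f : mor X Y) s t x :
  app f t (push X s t x) = push Y s t (app f s x).
Proof.
rewrite /push; case: {-}_ / idP => [st|_]; last by rewrite /= linear0.
exact: (@ntr_nat _ _ _ _ f s t st).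
Qed.

Lemma heqI X Y (f g : mor X Y) :
  (forall s x, app f s x = app g s x) -> heq f g.
Proof. by move=> fg s x; apply: fg. Qed.

Lemma heqE X Y (f g : mor X Y) :
  heq f g -> forall s x, app f s x = app g s x.
Proof. by move=> fg s x; apply: fg. Qed.

Lemma app_id X s x : app (idm X) s x = x. Proof. by []. Qed.

Lemma app_comp X Y Z (g : mor Y Z) (f : mor X Y) s x :
  app (compm g f) s x = app g s (app f s x).
Proof. by []. Qed.

Section Builders.
Variables (V : T -> lmodType k) (p : forall s t, {linear V s -> V t}).
Hypothesis p_id : forall s x, p s s x = x.
Hypothesis p_comp : forall s t u x,
  (s <= t)%O -> (t <= u)%O -> p t u (p s t x) = p s u x.

Definition mk_obj : Mod :=
  @Functor (order_category T) (vect_category k) V (fun s t _ => p s t)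
    (fun _ _ _ _ _ _ => erefl) p_id
    (fun s t u tu st x => esym (p_comp x st tu)).

Lemma push_mk_obj s t x : (s <= t)%O -> push mk_obj s t x = p s t x.
Proof. by rewrite /push => st; case: {-}_ / idP. Qed.
End Builders.

Section BuildMor.
Variables (X Y : Mod) (f : forall s, {linear stalk X s -> stalk Y s}).
Hypothesis f_push : forall s t x, (s <= t)%O ->
  f t (push X s t x) = push Y s t (f s x).

Fact mk_mor_subproof s t (st : @mor (order_category T) s t) x :
  f t (fmap (X : functor _ _) st x) = fmap (Y : functor _ _) st (f s x).
Proof.
have := @f_push s t x st; rewrite /push; case: {-}_ / idP => // st'.
by rewrite (bool_irrelevance st' st).
Qed.

Definition mk_mor : mor X Y :=
  @NatTrans (order_category T) (vect_category k) X Y f mk_mor_subproof.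
End BuildMor.

Definition relation X Y := forall s, stalk X s -> stalk Y s -> Prop.

(* A linear relation is a subobject of [X * Y]. *)
Record linear_relation X Y (R : relation X Y) : Prop := LinearRelation {
  lrel0 : forall s, R s 0 0;
  lrelP : forall s c x y x' y',
    R s x y -> R s x' y' -> R s (c *: x + x') (c *: y + y');
  lrel_push : forall s t x y, (s <= t)%O -> R s x y ->
    R t (push X s t x) (push Y s t y)
}.

(* For a linear relation this is single-valuedness. *)
Definition functional X Y (R : relation X Y) :=
  forall s y, R s 0 y -> y = 0.

Lemma lrelB X Y (R : relation X Y) s x y x' y' : linear_relation R ->
  R s x y -> R s x' y' -> R s (x - x') (y - y').
Proof.
move=> lR Rxy Rxy'; have := lrelP lR (-1) Rxy' Rxy.
by rewrite !scaleN1r ![- _ + _]addrC.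
Qed.

Lemma functional_inj X Y (R : relation X Y) s x y y' : linear_relation R ->
  functional R -> R s x y -> R s x y' -> y = y'.
Proof.
move=> lR fR Rxy Rxy'; apply/eqP; rewrite -subr_eq0; apply/eqP/fR.
by rewrite -(subrr x); apply: lrelB.
Qed.

(** Single-valuedness makes a pointwise choice of values linear and natural; this is the way to
    build a morphism that has no explicit formula. *)
Lemma functional_mor X Y (R : relation X Y) : linear_relation R ->
  functional R -> (forall s x, exists y, R s x y) ->
  exists f : mor X Y, forall s x, R s x (app f s x).
Proof.
move=> lR fR /(_ _ _)/cid tR.
pose f s (x : stalk X s) := sval (tR s x).
have fP s x : R s x (f s x) by rewrite /f; case: (tR s x).
have f_lin s : linear (f s).
  move=> c x y; apply: (functional_inj lR fR (fP _ _)).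
  exact: (lrelP lR c (fP _ _) (fP _ _)).
have f_push s t x : (s <= t)%O ->
    linear_map (f_lin t) (push X s t x) = push Y s t (linear_map (f_lin s) x).
  move=> st; apply: (functional_inj lR fR (fP _ _)).
  exact: (lrel_push lR st (fP _ _)).
by exists (mk_mor f_push) => s x; apply: fP.
Qed.

Definition zero_mor X Y : mor X Y :=
  @mk_mor X Y (fun s => \0) (fun s t x _ => esym (linear0 (push Y s t))).

Definition stalk_set X := forall s, stalk X s -> Prop.

Record subobject X (N : stalk_set X) : Prop := Subobject {
  sub_space : forall s, subspace (N s);
  sub_push : forall s t x, (s <= t)%O -> N s x -> N t (push X s t x)
}.

Lemma sub0 X (N : stalk_set X) s : subobject N -> N s 0.
Proof. by case=> sN _; case: (sN s). Qed.

Section SubQuotient.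
Variables (X : Mod) (N : stalk_set X).
Arguments N : clear implicits.
Hypothesis sN : subobject N.

Fact push_sub s t (x : stalk X s) : N s x -> N t (push X s t x).
Proof.
have [st|st] := boolP (s <= t)%O; first exact: (sub_push sN).
by rewrite push_nle // => _; apply: sub0.
Qed.

Local Notation sub_tr s t :=
  (restrict_map (sub_space sN s) (sub_space sN t) (@push_sub s t)).

Fact sub_push_id s (x : subspace_type (sub_space sN s)) : sub_tr s s x = x.
Proof. by apply/val_inj; rewrite /= push_id. Qed.

Fact sub_push_comp s t u (x : subspace_type (sub_space sN s)) :
  (s <= t)%O -> (t <= u)%O -> sub_tr t u (sub_tr s t x) = sub_tr s u x.
Proof. by move=> st tu; apply/val_inj; rewrite /= push_comp. Qed.

Definition sub_obj : Mod := mk_obj sub_push_id sub_push_comp.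

Definition sub_incl : mor sub_obj X.
Proof.
refine (@mk_mor sub_obj X
  (fun s => \val : {linear subspace_type (sub_space sN s) -> stalk X s}) _).
by move=> s t x st; rewrite push_mk_obj.
Defined.

Lemma sub_incl_inj s : injective (app sub_incl s).
Proof. exact: val_inj. Qed.

Lemma sub_incl_in s x : N s (app sub_incl s x).
Proof. by case: x => x Nx; apply/(in_subspaceP (sub_space sN s)). Qed.

Lemma sub_incl_onto s x : N s x -> exists y, app sub_incl s y = x.
Proof.
by move=> /(in_subspaceP (sub_space sN s)) Nx; exists (SubspaceElt Nx).
Qed.

Local Notation quo_tr s t :=
  (quotient_map (sub_space sN s) (sub_space sN t) (push X s t)).

Lemma quo_trE s t (x : stalk X s) :
  quo_tr s t (quotient_pi (sub_space sN s) x) =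
  quotient_pi (sub_space sN t) (push X s t x).
Proof. by rewrite quotient_mapE //; apply: push_sub. Qed.

Fact quo_tr_linear s t : linear (quo_tr s t).
Proof. exact/quotient_map_linear/push_sub. Qed.

Fact quo_push_id s (q : quotient_type (sub_space sN s)) : quo_tr s s q = q.
Proof. by elim/quotient_ind: q => x; rewrite quo_trE push_id. Qed.

Fact quo_push_comp s t u (q : quotient_type (sub_space sN s)) :
  (s <= t)%O -> (t <= u)%O -> quo_tr t u (quo_tr s t q) = quo_tr s u q.
Proof.
by move=> st tu; elim/quotient_ind: q => x; rewrite !quo_trE push_comp.
Qed.

Definition quo_obj : Mod :=
  @mk_obj (fun s => quotient_type (sub_space sN s))
    (fun s t => linear_map (@quo_tr_linear s t)) quo_push_id quo_push_comp.

Fact quo_proj_push s t (x : stalk X s) : (s <= t)%O ->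
  quotient_pi (sub_space sN t) (push X s t x) =
  push quo_obj s t (quotient_pi (sub_space sN s) x).
Proof. by move=> st; rewrite push_mk_obj //= quo_trE. Qed.

Definition quo_proj : mor X quo_obj :=
  @mk_mor X quo_obj (fun s => quotient_pi (sub_space sN s)) quo_proj_push.

Lemma quo_proj_eq0 s x : app quo_proj s x = 0 <-> N s x.
Proof.
by have := quotient_piP (sub_space sN s) x 0; rewrite subr0 linear0.
Qed.
End SubQuotient.
End Representations.

(** * Interval modules *)

Section Interval.
Variables (k : fieldType) (d : Order.disp_t) (T : orderType d).
Local Notation Mod := (Mod k T).
Implicit Types (X Y Z : Mod) (s t u : T) (D J : pred T).

Definition convex D :=
  forall s t u, (s <= t)%O -> (t <= u)%O -> D s -> D u -> D t.

Section IntervalModule.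
Variables (D : pred T) (cD : convex D).

Fact interval_push_comp s t u (v : 'rV[k]_(D s)) : (s <= t)%O -> (t <= u)%O ->
  rVtr k (D t) (D u) (rVtr k (D s) (D t) v) = rVtr k (D s) (D u) v.
Proof. by move=> st tu; apply: rVtr_comp; apply: cD. Qed.

Definition interval_obj : Mod :=
  @mk_obj k d T (fun s => 'rV[k]_(D s) : lmodType k)
    (fun s t => rVtr k (D s) (D t)) (fun s => @rVtr_id k (D s))
    interval_push_comp.

Definition interval_one s : stalk interval_obj s :=
  const_mx 1 : 'rV[k]_(D s).

Lemma interval_in s (v : stalk interval_obj s) : v <> 0 -> D s.
Proof. exact: rV_neq0. Qed.

Lemma interval_out s (v w : stalk interval_obj s) : ~~ D s -> v = w.
Proof.
by move=> nDs; case: (pselect (v - w = 0)) => [/subr0_eq//|/interval_in];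
  rewrite (negPf nDs).
Qed.

Lemma interval_push_eq0 s t (v : stalk interval_obj s) :
  (s <= t)%O -> D t -> push interval_obj s t v = 0 -> v = 0.
Proof. by move=> st Dt; rewrite push_mk_obj //; apply: rVtr_eq0. Qed.

Lemma interval_one_neq0 s : D s -> interval_one s <> 0.
Proof. exact: const_mx1_neq0. Qed.

Lemma push_interval_one s t : (s <= t)%O -> D s ->
  push interval_obj s t (interval_one s) = interval_one t.
Proof. by move=> st Ds; rewrite push_mk_obj //; apply: rVtr_const. Qed.

Lemma interval_span s (v : stalk interval_obj s) :
  exists a, v = a *: interval_one s.
Proof.
have [a ->] := rV_const v; exists a.
by apply/rowP=> j; rewrite !mxE mulr1.
Qed.

Section MorFromInterval.
Variables (X : Mod) (e : forall s, stalk X s).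
Hypothesis e_push : forall s t, (s <= t)%O -> D s -> D t ->
  push X s t (e s) = e t.
Hypothesis e_out : forall s t, (s <= t)%O -> D s -> ~~ D t ->
  push X s t (e s) = 0.

(** The row [v] has one entry or none, so the sum reads off its coordinate without a case
    distinction on [D s]. *)
Definition interval_mor_fun s (v : stalk interval_obj s) : stalk X s :=
  (\sum_j (v : 'rV[k]_(D s)) 0 j) *: e s.

Fact interval_mor_linear s : linear (@interval_mor_fun s).
Proof.
move=> c v w; rewrite /interval_mor_fun scalerA -scalerDl mulr_sumr -big_split.
by congr (_ *: _); apply: eq_bigr => j _; rewrite !mxE.
Qed.

Lemma interval_mor_one s : D s -> interval_mor_fun (interval_one s) = e s.
Proof.
rewrite /interval_mor_fun /interval_one; move: (e s); case: (D s) => // x _.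
by rewrite big_ord1 mxE scale1r.
Qed.

Lemma interval_morZ s a :
  D s -> interval_mor_fun (a *: interval_one s) = a *: e s.
Proof.
move=> Ds; rewrite -(interval_mor_one Ds).
exact: (linearZ_LR (linear_map (@interval_mor_linear s))) a _.
Qed.

Fact interval_mor_push s t (v : stalk interval_obj s) : (s <= t)%O ->
  linear_map (@interval_mor_linear t) (push interval_obj s t v) =
  push X s t (linear_map (@interval_mor_linear s) v).
Proof.
move=> st; have [Ds|nDs] := boolP (D s); last first.
  by rewrite (interval_out v 0 nDs) !linear0.
have [a ->] := interval_span v.
rewrite [push interval_obj _ _ _]linearZ push_interval_one //=.
rewrite (interval_morZ a Ds) linearZ_LR; have /orP[Dt|nDt] := orbN (D t).
  by rewrite (interval_morZ a Dt) e_push.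
rewrite e_out // scaler0.
have -> : a *: interval_one t = 0 by exact: interval_out.
exact: (linear0 (linear_map (@interval_mor_linear t))).
Qed.

Definition interval_mor : mor interval_obj X := mk_mor interval_mor_push.

Lemma app_interval_mor s : D s -> app interval_mor s (interval_one s) = e s.
Proof. exact: interval_mor_one. Qed.
End MorFromInterval.
End IntervalModule.
End Interval.

(** * Essential and uniform subobjects *)

Section Essential.
Variables (k : fieldType) (d : Order.disp_t) (T : orderType d).
Local Notation Mod := (Mod k T).
Implicit Types (X Y Z : Mod) (s t u : T).

Lemma push_neq0_le X s t x : push X s t x <> 0 -> (s <= t)%O.
Proof. by case: (boolP (s <= t)%O) => // /push_nle ->. Qed.

Lemma app_inj X Y (f : mor X Y) s :
  (forall x, app f s x = 0 -> x = 0) -> injective (app f s).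
Proof.
by move=> f0 x y fxy; apply/subr0_eq/f0; rewrite linearB /= fxy subrr.
Qed.

Lemma preim_subobject X Y (f : mor X Y) (N : stalk_set Y) : subobject N ->
  subobject (fun s x => N s (app f s x)).
Proof.
move=> sN; split=> [s|s t x st]; last by rewrite app_push; apply: sub_push.
split=> [|c x y]; first by rewrite linear0; apply: sub0.
by rewrite linearP; case: (sub_space sN s) => _; apply.
Qed.

Lemma zero_subobject X : @subobject k d T X (fun s x => x = 0).
Proof.
split=> [s|s t x _ ->]; last exact: linear0.
by split=> // c x y -> ->; rewrite scaler0 addr0.
Qed.

(** The inclusion of the kernel and the zero map have the same composite with [f]. *)
Lemma is_mono_inj X Y (f : mor X Y) :
  is_mono f -> forall s, injective (app f s).
Proof.
move=> mf s; apply: app_inj => x fx.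
have sK := preim_subobject f (zero_subobject Y).
have /heqE incl0 : heq (sub_incl sK) (zero_mor (sub_obj sK) X).
  by apply: mf; apply: heqI=> t y; rewrite !app_comp (sub_incl_in y) linear0.
by have [y <-] := sub_incl_onto sK fx; apply: (incl0 s y).
Qed.

Lemma inj_is_mono X Y (f : mor X Y) :
  (forall s, injective (app f s)) -> is_mono f.
Proof.
move=> f_inj Z u v /heqE fuv; apply: heqI => s x.
by apply: (f_inj s); apply: (fuv s x).
Qed.

Definition trivial X := forall s (x : stalk X s), x = 0.

Lemma zero_trivial X : is_zero X -> trivial X.
Proof.
case=> /(_ X)[f fP] _ s x.
by rewrite -[x]app_id (heqE (fP (idm X))) -(heqE (fP (zero_mor X X))).
Qed.

Lemma trivial_is_zero X : trivial X -> is_zero X.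
Proof.
move=> X0; split=> Y; [exists (zero_mor X Y)|exists (zero_mor Y X)] => g;
  apply: heqI=> s x; last by rewrite [LHS]X0 [RHS]X0.
by rewrite (X0 s x) !linear0.
Qed.

Lemma nontrivial X : ~ trivial X -> exists s (x : stalk X s), x <> 0.
Proof.
move=> ntX; apply: contrapT => X0; apply: ntX => s x; apply: contrapT => x0.
by apply: X0; exists s, x.
Qed.

(** The subobject generated by [x] consists of the multiples of its pushes, so for a subobject [N]
    this says that [N] meets every nonzero subobject. *)
Definition essential X (N : stalk_set X) :=
  forall s x, x <> 0 -> exists t, push X s t x <> 0 /\ N t (push X s t x).

Definition stalk_image X Y (f : mor X Y) : stalk_set Y :=
  fun s y => exists x, app f s x = y.

Lemma stalk_image_subobject X Y (f : mor X Y) : subobject (stalk_image f).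
Proof.
split=> [s|s t _ st [x <-]]; last by exists (push X s t x); rewrite app_push.
split=> [|c _ _ [x <-] [y <-]]; first by exists 0; rewrite linear0.
by exists (c *: x + y); rewrite linearP.
Qed.

Lemma essentialS X (N N' : stalk_set X) :
  (forall s x, N s x -> N' s x) -> essential N -> essential N'.
Proof.
move=> NN' eN s x /(eN s x)[t [xt Nt]]; exists t; split=> //; exact: NN'.
Qed.

Definition span1 X s (x : stalk X s) : stalk_set X :=
  fun t y => exists a, y = a *: push X s t x.

Lemma span1_quotient_subobject X s (x : stalk X s) :
  subobject (fun t y => (s <= t)%O /\ span1 x y \/ y = 0).
Proof.
split=> [t|t u y tu]; last first.
  case=> [[st [a ->]]|->]; last by right; rewrite linear0.
  by left; split; [exact: le_trans tu|exists a; rewrite linearZ /= push_comp].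
split=> [|c y z]; first by right.
case=> [[st [a ->]]|->] [[st' [b ->]]|->].
- by left; split=> //; exists (c * a + b); rewrite scalerDl scalerA.
- by left; split=> //; exists (c * a); rewrite addr0 scalerA.
- by left; split=> //; exists b; rewrite scaler0 add0r.
- by right; rewrite scaler0 addr0.
Qed.

(* If [x <> 0] and the span of [x] misses the image of [m], then [m] followed by
   the projection modulo that span is still a monomorphism. *)
Lemma essential_mono_image X Y (m : mor X Y) :
  is_essential_mono m -> essential (stalk_image m).
Proof.
case=> mono_m ess_m s y y0; apply: contrapT => im0.
have sS := span1_quotient_subobject y.
have /is_mono_inj/(_ s y 0) : is_mono (quo_proj sS).
  apply: ess_m; apply: inj_is_mono => t; apply: app_inj => x /quo_proj_eq0 Sx.
  apply: (is_mono_inj mono_m (s := t)); rewrite linear0.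
  case: Sx => // [[st [a mx]]]; rewrite mx.
  have [->|a0] := eqVneq a 0; first by rewrite scale0r.
  suff -> : push Y s t y = 0 by rewrite scaler0.
  apply: contrapT => yt0; apply: im0; exists t; split=> //.
  by exists (a^-1 *: x); rewrite linearZ /= mx scalerA mulVf ?scale1r.
move=> y_inj; apply/y0/y_inj; rewrite linear0; apply/quo_proj_eq0; left.
by split=> //; exists 1; rewrite push_id scale1r.
Qed.

Lemma essential_mono X Y (m : mor X Y) : (forall s, injective (app m s)) ->
  essential (stalk_image m) -> is_essential_mono m.
Proof.
move=> m_inj im; split=> [|Z g /is_mono_inj gm_inj]; first exact: inj_is_mono.
apply: inj_is_mono => s; apply: app_inj => y gy; apply: contrapT => /im[t].
case=> yt0 [x mx]; apply: yt0; rewrite -mx.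
suff -> : x = 0 by rewrite linear0.
by apply: (gm_inj t); rewrite app_comp mx linear0 app_push gy linear0.
Qed.

Definition uniform X := ~ trivial X /\ forall N : stalk_set X, subobject N ->
  (exists s x, N s x /\ x <> 0) -> essential N.

(** Two nonzero elements are pushed to the larger of their indices, which lies in [D] as it is one
    of the two. Neither push vanishes and the stalk there is a line, so the pushes are
    proportional. *)
Lemma interval_uniform (D : pred T) (cD : convex D) :
  (exists s, D s) -> uniform (interval_obj k cD).
Proof.
case=> s0 Ds0; split=> [/(_ s0 (interval_one k cD s0))|].
  exact: interval_one_neq0.
move=> N sN [s [x [Nx x0]]] t y y0.
have Ds := interval_in x0; have Dt := interval_in y0.
have D_max : D (Order.max s t) by rewrite /Order.max; case: ifP.
have [sm tm] : (s <= Order.max s t)%O /\ (t <= Order.max s t)%O.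
  by rewrite !le_max !lexx orbT.
exists (Order.max s t); split.
  by move=> /(interval_push_eq0 tm D_max).
have [a ya] := interval_span (push _ t (Order.max s t) y).
have [b xb] := interval_span (push _ s (Order.max s t) x).
have b0 : b != 0.
  apply/eqP => b0; apply: x0; apply: (interval_push_eq0 sm D_max).
  by rewrite xb b0 scale0r.
rewrite ya -[_ *: _](_ : (a / b) *: push _ s _ x = _); last first.
  by rewrite xb scalerA divfK.
exact: subspaceZ (sub_space sN _) _ _ (sub_push sN sm Nx).
Qed.

End Essential.

(** * Injectivity of down-set modules *)

Section Injective.
Variables (k : fieldType) (d : Order.disp_t) (T : orderType d).
Local Notation Mod := (Mod k T).
Implicit Types (X Y Z : Mod) (s t u : T).

Local Open Scope classical_set_scope.

(** * Maximal extensions of a partial map *)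

Section MaximalRelation.
Variables (X Y : Mod) (R0 : relation X Y).
Hypotheses (lR0 : linear_relation R0) (fR0 : functional R0).

Let triple : Type := {s : T & (stalk X s * stalk Y s)%type}.
(** Adding [R0] to every candidate makes the empty chain harmless: its union still yields the
    relation [R0]. *)
Let rel_of (A : set triple) : relation X Y :=
  fun s x y => R0 x y \/ A (existT _ s (x, y)).

Lemma maximal_functional_relation : exists R : relation X Y,
  [/\ linear_relation R, functional R,
    forall s x y, R0 (s := s) x y -> R s x y &
    forall R' : relation X Y, linear_relation R' -> functional R' ->
      (forall s x y, R s x y -> R' s x y) -> forall s x y, R' s x y -> R s x y].
Proof.
pose P A := linear_relation (rel_of A) /\ functional (rel_of A).
have [F FP Ftot|A [[lA fA] maxA]] := @Zorn_bigcup triple P; last first.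
  exists (rel_of A); split=> //; first by left.
  move=> R' lR' fR' AR' s x y R'xy; apply: contrapT => nAxy.
  pose A' : set triple := fun p => R' (tag p) (tagged p).1 (tagged p).2.
  have relA' u x' y' : rel_of A' (s := u) x' y' <-> R' u x' y'.
    by split=> [[/or_introl/AR'|]|]; last right.
  apply: (maxA A').
    split=> [|A'A]; last by apply: nAxy; right; apply: A'A.
    by move=> [u [x' y']] Ap; apply: AR'; right.
  split; last by move=> u z /relA'/fR'.
  split=> [u|u c x1 y1 x2 y2 /relA' R1 /relA' R2|u v x1 y1 uv /relA' R1].
  - exact/relA'/(lrel0 lR').
  - exact/relA'/(lrelP lR').
  - exact/relA'/(lrel_push lR').
(* A pair of the union lies in one admissible candidate below it; for a pair of [R0] this is the
   empty set, since the chain may have no members. *)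
have F1 s x y : rel_of (\bigcup_(A in F) A) (s := s) x y ->
    exists A, [/\ P A, A `<=` \bigcup_(A in F) A & rel_of A x y].
  case=> [Rxy|[A FA Axy]].
    exists set0; split; [|by move=> p []|by left].
    have rel0 u x1 y1 : rel_of set0 (s := u) x1 y1 <-> R0 x1 y1.
      by split=> [[]|]; last left.
    split; last by move=> u z /rel0/fR0.
    split=> [u|u c x1 y1 x2 y2 /rel0 R1 /rel0 R2|u v x1 y1 uv /rel0 R1].
    + exact/rel0/(lrel0 lR0).
    + exact/rel0/(lrelP lR0).
    + exact/rel0/(lrel_push lR0).
  by exists A; split; [exact: FP|move=> p Ap; exists A|right].
have relS (A B : set triple) s x y :
    A `<=` B -> rel_of A (s := s) x y -> rel_of B x y.
  by move=> AB [|/AB]; [left|right].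
(* The chain condition puts two pairs into one candidate, as closure under linear combinations
   requires. *)
have F2 s (x1 x2 : stalk X s) (y1 y2 : stalk Y s) :
    rel_of (\bigcup_(A in F) A) (s := s) x1 y1 ->
    rel_of (\bigcup_(A in F) A) x2 y2 ->
    exists A, [/\ P A, A `<=` \bigcup_(A in F) A, rel_of A x1 y1 &
      rel_of A x2 y2].
  case=> [R1|[A FA A1]] R2.
    by have [A [PA AF R2']] := F1 _ _ _ R2; exists A; split=> //; left.
  have FU B : F B -> B `<=` \bigcup_(A in F) A by move=> FB p Bp; exists B.
  case: R2 => [R2|[B FB B2]].
    by exists A; split; [exact: FP|exact: FU|right|left].
  have [AB|BA] := Ftot _ _ FA FB.
    by exists B; split; [exact: FP|exact: FU|right; exact: AB|right].
  by exists A; split; [exact: FP|exact: FU|right|right; exact: BA].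
split; last by move=> s y /F1[A [[_ fA] _ /fA]].
split=> [s|s c x y x' y' R1 R2|s t x y st /F1[A [[lA _] AF Rxy]]].
- by left; apply: (lrel0 lR0).
- have [A [[lA _] AF R1' R2']] := F2 _ _ _ _ _ R1 R2.
  exact: (relS _ _ _ _ _ AF (lrelP lA c R1' R2')).
- exact: (relS _ _ _ _ _ AF (lrel_push lA st Rxy)).
Qed.
End MaximalRelation.

(** * Extending a partial map by one element *)

Section Adjoin.
Variables (X Y : Mod) (R : relation X Y).
Variables (t : T) (b : stalk X t) (y0 : stalk Y t).
Arguments R : clear implicits.
Hypotheses (lR : linear_relation R) (fR : functional R).
Hypothesis R_b : forall s y, (t <= s)%O -> R s (push X t s b) y ->
  y = push Y t s y0.

(** The sum of [R] and the subobject of [X * Y] generated by [(b, y0)]; at indices not above [t]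
    both pushes vanish and nothing is added. *)
Definition adjoin : relation X Y := fun s x y => exists a x1 y1,
  [/\ R s x1 y1, x = a *: push X t s b + x1 & y = a *: push Y t s y0 + y1].

Lemma adjoin_sub s x y : R s x y -> adjoin x y.
Proof. by move=> Rxy; exists 0, x, y; rewrite !scale0r !add0r. Qed.

Lemma adjoin_new : adjoin b y0.
Proof.
by exists 1, 0, 0; split; [exact: (lrel0 lR)|..]; rewrite push_id scale1r addr0.
Qed.

Lemma adjoin_linear : linear_relation adjoin.
Proof.
split=> [s|s c _ _ _ _ [a [x [y [Rxy -> ->]]]] [a' [x' [y' [Rxy' -> ->]]]]|].
- exact/adjoin_sub/(lrel0 lR).
- exists (c * a + a'), (c *: x + x'), (c *: y + y').
  split; first exact: (lrelP lR).
    by rewrite scalerDl scalerDr scalerA addrACA.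
  by rewrite scalerDl scalerDr scalerA addrACA.
- move=> s u _ _ su [a [x [y [Rxy -> ->]]]].
  have [ts|ts] := boolP (t <= s)%O; last first.
    rewrite !(push_nle _ ts) !scaler0 !add0r.
    exact/adjoin_sub/(lrel_push lR).
  exists a, (push X s u x), (push Y s u y).
  by split; [exact: (lrel_push lR)|rewrite linearP /= push_comp..].
Qed.

(** If a nonzero multiple of the push of [b] cancels [x], that push is in the domain of [R]; [R_b]
    then makes its value the push of [y0], so the values cancel as well. *)
Lemma adjoin_functional : functional adjoin.
Proof.
move=> s _ [a [x [y [Rxy /esym/eqP + ->]]]]; rewrite addr_eq0 => /eqP bx.
have [ts|ts] := boolP (t <= s)%O; last first.
  rewrite push_nle // scaler0 add0r; move: bx.
  rewrite push_nle // scaler0 => /esym/eqP; rewrite oppr_eq0 => /eqP x0.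
  by apply: fR; rewrite -x0.
have [a0|a0] := eqVneq a 0.
  move: bx; rewrite a0 !scale0r add0r => /esym/eqP.
  by rewrite oppr_eq0 => /eqP x0; apply: fR; rewrite -x0.
have : R s (push X t s b) (- a^-1 *: y).
  have -> : push X t s b = - a^-1 *: x.
    by rewrite scaleNr -scalerN -bx scalerA mulVf ?scale1r.
  by have := lrelP lR (- a^-1) Rxy (lrel0 lR s); rewrite !addr0.
by move=> /(R_b ts) <-; rewrite scalerA mulrN divff // scaleN1r addNr.
Qed.
End Adjoin.

(* Baer's criterion, [y0] being the value at the new element [b]. *)
Lemma injective_criterion Y :
  (forall X (R : relation X Y) t b, linear_relation R -> functional R ->
     exists y0, forall s y, (t <= s)%O -> R s (push X t s b) y ->
       y = push Y t s y0) ->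
  is_injective Y.
Proof.
move=> extY A X m f /is_mono_inj m_inj.
pose R0 : relation X Y := fun s x y => exists a, app m s a = x /\ app f s a = y.
have lR0 : linear_relation R0.
  split=> [s|s c _ _ _ _ [a [<- <-]] [a' [<- <-]]|s t _ _ st [a [<- <-]]].
  - by exists 0; rewrite !linear0.
  - by exists (c *: a + a'); rewrite !linearP.
  - by exists (push A s t a); rewrite !app_push.
have fR0 : functional R0.
  by move=> s y [a [/eqP + <-]]; rewrite -(linear0 (app m s)) => /eqP/m_inj->;
    rewrite linear0.
have [R [lR fR R0R maxR]] := maximal_functional_relation lR0 fR0.
have totR s x : exists y, R s x y.
  have [y0 y0P] := extY X R s x lR fR; exists y0.
  apply: (maxR (adjoin R x y0)).
  - exact: adjoin_linear.
  - exact: adjoin_functional.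
  - exact: adjoin_sub.
  - exact: adjoin_new.
have [g gP] := functional_mor lR fR totR.
exists g; apply: heqI=> s a; apply: (functional_inj lR fR (gP _ _)).
by apply: R0R; exists a.
Qed.

Lemma down_set_convex (D : pred T) :
  (forall s t, (s <= t)%O -> D t -> D s) -> convex D.
Proof. by move=> dD s t u _ tu _; apply: dD. Qed.

(** If no push of [b] at an index of [D] is in the domain of [R], every constraint sits in a zero
    stalk and [0] will do. Otherwise a single constraint at [s] determines [y0]: [t] is in [D]
    because [D] is a down-set, and the transition from [t] to [s] is the identity of [k]. *)
Lemma interval_injective (D : pred T) (cD : convex D) :
  (forall s t, (s <= t)%O -> D t -> D s) -> is_injective (interval_obj k cD).
Proof.
move=> dD; apply: injective_criterion => X R t b lR fR.
have [[s [y [ts Ds Rby]]]|noR] := pselect (exists s y,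
    [/\ (t <= s)%O, D s & R s (push X t s b) y]); last first.
  exists 0 => s y ts Rby; apply: interval_out; apply/negP => Ds.
  by apply: noR; exists s, y.
have [a ya] := interval_span y; have Dt := dD _ _ ts Ds.
have y_push : push _ t s (a *: interval_one k cD t) = y.
  by rewrite linearZ /= push_interval_one // ya.
exists (a *: interval_one k cD t) => u z tu Rbz.
have [Du|nDu] := boolP (D u); last exact: interval_out.
(* The constraint at [u] is compared with the one at [s] at the larger index, where both concern the
   same push of [b]. *)
pose v := Order.max s u.
have Dv : D v by rewrite /v /Order.max; case: ifP.
have [sv uv] : (s <= v)%O /\ (u <= v)%O by rewrite !le_max !lexx orbT.
apply/subr0_eq/(interval_push_eq0 uv Dv); rewrite linearB /= push_comp //.
apply/eqP; rewrite subr_eq0.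
apply/eqP/(functional_inj lR fR (x := push X t v b)).
  by rewrite -(push_comp b tu uv); apply: (lrel_push lR).
rewrite -(push_comp b ts sv) -(push_comp _ ts sv) y_push.
exact: (lrel_push lR).
Qed.

(** The universal property supplies projections, so the images of the two summands meet in zero;
    uniformity forbids both to be nonzero. *)
Lemma uniform_indecomposable X : uniform X -> is_indecomposable X.
Proof.
case=> ntX uX; split=> [/zero_trivial//|F inj cop].
have split_inj b : exists h : mor X (F b),
    (forall s x, app h s (app (inj b) s x) = x) /\
    (forall s x, app h s (app (inj (~~ b)) s x) = 0).
  pose f b b' : mor (F b') (F b) :=
    match b as c, b' as c' return mor (F c') (F c) with
    | true, true => idm (F true)
    | false, false => idm (F false)
    | c, c' => zero_mor (F c') (F c)
    end.
  have [h [hf _]] := cop (F b) (f b).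
  exists h; split=> s x; rewrite -app_comp (heqE (hf _)).
    by case: b {h hf} x.
  by case: b {h hf} x.
have [/trivial_is_zero|/nontrivial[s [x x0]]] := pselect (trivial (F true)).
  by left.
right; apply: trivial_is_zero => t y; apply: contrapT => y0.
have inj_neq0 b u z : z <> 0 -> app (inj b) u z <> 0.
  have [h [hK _]] := split_inj b.
  by move=> z0 iz0; apply: z0; rewrite -[z]hK iz0 linear0.
have /(uX _ (stalk_image_subobject (inj true))) ess :
    exists s (x : stalk X s), stalk_image (inj true) x /\ x <> 0.
  by exists s, (app (inj true) s x); split; [exists x|exact: inj_neq0].
have [u [yu0 [z zy]]] := ess _ _ (inj_neq0 false t y y0).
have [h [hK h0]] := split_inj true.
apply: yu0; rewrite -zy -[z]hK zy -app_push h0.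
exact: linear0.
Qed.

End Injective.

(** * Independent families *)

Section Independence.
Variables (k : fieldType) (V : lmodType k) (I : choiceType).
Implicit Types (M : I -> V -> Prop) (P : set I).

(** The internal sum of the [M i] over [P]. The inductive form suits induction along pushes;
    [sum_onP] merges repeated indices when independence, stated for duplicate-free sequences, is
    applied. *)
Inductive sum_on P M : V -> Prop :=
| sum_on0 : sum_on P M 0
| sum_onD i u v : P i -> M i u -> sum_on P M v -> sum_on P M (u + v).

Definition independent_on P M := forall (r : seq I) (a : I -> V), uniq r ->
  (forall i, i \in r -> P i /\ M i (a i)) -> \sum_(i <- r) a i = 0 ->
  forall i, i \in r -> a i = 0.

Lemma sum_on_subspace P M : (forall i, subspace (M i)) -> subspace (sum_on P M).
Proof.
move=> sM; split=> [|c u v Su Sv]; first exact: sum_on0.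
elim: Su => [|i x y Pi Mx _ IH]; first by rewrite scaler0 add0r.
by rewrite scalerDr -addrA; apply: (sum_onD Pi (subspaceZ (sM i) c Mx) IH).
Qed.

Lemma sum_on_mem P M i u : P i -> M i u -> sum_on P M u.
Proof.
by move=> Pi Mu; rewrite -[u]addr0; apply: (sum_onD Pi Mu (sum_on0 _ _)).
Qed.

Lemma sum_on_big P M (r : seq I) (a : I -> V) :
  (forall i, i \in r -> P i /\ M i (a i)) -> sum_on P M (\sum_(i <- r) a i).
Proof.
elim: r => [|i r IH] aP; first by rewrite big_nil; apply: sum_on0.
rewrite big_cons; have [Pi Mi] := aP i (mem_head _ _).
by apply: (sum_onD Pi Mi); apply: IH => j jr; apply: aP; rewrite inE jr orbT.
Qed.

Lemma sum_onP P M v : (forall i, subspace (M i)) -> sum_on P M v ->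
  exists (r : seq I) (a : I -> V), [/\ uniq r,
    forall i, i \in r -> P i /\ M i (a i) & v = \sum_(i <- r) a i].
Proof.
move=> sM; elim=> [|i u w Pi Mu _ [r [a [r_uniq aP ->]]]].
  by exists [::], (fun=> 0); rewrite big_nil.
have [ir|ir] := boolP (i \in r).
  exists r, (fun j => if j == i then u + a i else a j); split=> // [j jr|].
    case: eqP => [->|_]; last exact: aP.
    by split=> //; apply: (subspaceD (sM i) Mu (aP i ir).2).
  rewrite !(bigD1_seq i) //= eqxx addrA; congr (_ + _).
  by apply: eq_bigr => j /negPf ->.
exists (i :: r), (fun j => if j == i then u else a j).
split=> [|j|]; first by rewrite /= ir.
  by rewrite inE; case: eqP => [->|_ /aP].
rewrite big_cons eqxx; congr (_ + _); apply: eq_big_seq => j jr.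
by case: eqP => // ji; rewrite -ji jr in ir.
Qed.

End Independence.

(** * Maximal independent families of subobjects *)

Section MaximalFamily.
Variables (k : fieldType) (d : Order.disp_t) (T : orderType d).
Local Notation Mod := (Mod k T).
Implicit Types (X Y Z : Mod) (s t u : T).

Lemma sum_on_subobject X (I : choiceType) (P : set I) (N : I -> stalk_set X) :
  (forall i, subobject (N i)) ->
  subobject (fun s => sum_on P (fun i x => N i s x)).
Proof.
move=> sN; split=> [s|s t x st].
  by apply: sum_on_subspace => i; apply: (sub_space (sN i)).
elim=> [|i u v Pi Nu _ IH]; first by rewrite linear0; apply: sum_on0.
by rewrite linearD; apply: (sum_onD Pi _ IH); apply: (sub_push (sN i)).
Qed.

(** The preimage of [K] in [U] is nonzero, hence essential. This provides the hypothesis [N_meet] of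
    the maximal family below. *)
Lemma uniform_meet U X (f : mor U X) (K : stalk_set X) t (x : stalk U t)
    s (y : stalk U s) : uniform U ->
  subobject K -> (forall r, injective (app f r)) -> x <> 0 -> y <> 0 ->
  K s (app f s y) -> exists r, push X t r (app f t x) <> 0 /\
    K r (push X t r (app f t x)).
Proof.
move=> [_ uU] sK f_inj x0 y0 Ky.
have [|r [xr0 Kr]] := uU _ (preim_subobject f sK) _ t x x0.
  by exists s, y.
exists r; rewrite -app_push; split=> //.
by rewrite -(linear0 (app f r)) => /f_inj.
Qed.

Variable X : Mod.
Local Notation point := {t : T & stalk X t}.
Variable N : point -> stalk_set X.
Arguments N : clear implicits.
Hypothesis sN : forall p, subobject (N p).
Hypothesis N_self : forall p : point, tagged p <> 0 -> N p _ (tagged p).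
Hypothesis N_meet : forall (p : point) (K : stalk_set X) s y, subobject K ->
  tagged p <> 0 -> N p s y -> K s y -> y <> 0 ->
  exists r, push X (tag p) r (tagged p) <> 0 /\
    K r (push X (tag p) r (tagged p)).

(** If no nonzero push of [x] lies in the sum, the point of [x] can be added to the family: a
    dependency with a nonzero component there would make its subobject meet the sum, and [N_meet]
    would put a nonzero push of [x] itself into the sum. *)
Lemma maximal_independent : exists P : set point,
  [/\ forall p, P p -> tagged p <> 0,
      forall s, independent_on P (fun p y => N p s y) &
      essential (fun s => sum_on P (fun p y => N p s y))].
Proof.
pose good (P : set point) := (forall p, P p -> tagged p <> 0) /\
  forall s, independent_on P (fun p y => N p s y).
have [F Fgood Ftot|P [[P0 indP] maxP]] := @Zorn_bigcup point good.
  (* A dependency involves finitely many indices, which already occur in one member of the chain;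
     the empty sequence is set apart because the chain may be empty. *)
  have seqF (r : seq point) :
      (forall p, p \in r -> (\bigcup_(A in F) A)%classic p) ->
      r = [::] \/ exists2 A, F A & forall p, p \in r -> A p.
    elim: r => [|p r IH] rF; [by left|right].
    have [B FB Bp] := rF p (mem_head _ _).
    have [q qr|->|[A FA Ar]] := IH; first by apply: rF; rewrite inE qr orbT.
      by exists B => // q; rewrite inE => /eqP ->.
    have [AB|BA] := Ftot _ _ FA FB.
      by exists B => // q; rewrite inE => /predU1P[->//|/Ar/AB].
    by exists A => // q; rewrite inE => /predU1P[->|/Ar//]; apply: BA.
  split=> [p [A FA Ap]|s r a r_uniq aP sum0]; first exact: (Fgood _ FA).1.
  have [p pr|->//|[A FA Ar]] := seqF r; first by case: (aP p pr).
  apply: ((Fgood _ FA).2 s r a) => // p pr; split; first exact: Ar.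
  by case: (aP p pr).
exists P; split=> // t x x0; apply: contrapT => noS.
pose p : point := existT _ t x; pose P' : set point := (P `|` [set p])%classic.
have nPp : ~ P p.
  move=> Pp; apply: noS; exists t; rewrite push_id; split=> //.
  by apply: (sum_on_mem Pp); apply: (N_self (p := p)).
apply: (maxP P').
  by split=> [q|/(_ p)]; [left|move/(_ (or_intror erefl))].
split=> [q [/P0//|->//]|s r a r_uniq aP sum0].
have aP1 q : q \in r -> q != p -> P q /\ N q s (a q).
  by move=> /aP[[//|->]]; rewrite eqxx.
have [pr|pr] := boolP (p \in r); last first.
  apply: (indP s) => // q qr; apply: aP1 => //.
  by apply: contraNneq pr => <-.
move: sum0; rewrite (big_rem p) //= => sum0.
have rem_in q : q \in rem p r -> q \in r /\ q != p.
  by rewrite mem_rem_uniq // => /andP[].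
have ap0 : a p = 0.
  apply: contrapT => ap0; apply: noS.
  have sS := sum_on_subobject P sN.
  apply: (@N_meet p _ s (a p) sS) => //; first by case: (aP p pr).
  move/eqP: sum0; rewrite addr_eq0 => /eqP ->.
  apply: (subspaceN (sub_space sS s)); apply: sum_on_big => q /rem_in[qr qp].
  exact: aP1.
move: sum0; rewrite ap0 add0r => sum0 q qr.
have [->//|qp] := eqVneq q p.
apply: (indP s (rem p r) a) => //; first exact: rem_uniq.
  by move=> q' /rem_in[q'r q'p]; apply: aP1.
by rewrite mem_rem_uniq // inE qp.
Qed.

End MaximalFamily.

(** * Internal direct sums *)

Section FamilyOfSubobjects.
Variables (k : fieldType) (d : Order.disp_t) (T : orderType d).
Local Notation Mod := (Mod k T).
Implicit Types (Y Z : Mod) (s t : T).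

Lemma lift_sub Y X (N : stalk_set X) (sN : subobject N) (g : mor Y X) :
  (forall s y, N s (app g s y)) ->
  exists h : mor Y (sub_obj sN), forall s y,
    app (sub_incl sN) s (app h s y) = app g s y.
Proof.
move=> gN; pose R : relation Y (sub_obj sN) :=
  fun s y z => app (sub_incl sN) s z = app g s y.
have [|||h hP] := @functional_mor _ _ _ _ _ R; last by exists h.
- split=> [s|s c y z y' z' yz yz'|s t y z st yz]; first by rewrite /R !linear0.
    by rewrite /R !linearP yz yz'.
  by rewrite /R !app_push yz.
- by move=> s z; rewrite /R linear0 -[RHS](linear0 (app (sub_incl sN) s));
    apply: sub_incl_inj.
- by move=> s y; apply: (sub_incl_onto sN).
Qed.

Variables (X : Mod) (I : choiceType) (F : I -> Mod).
Variable f : forall i, mor (F i) X.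
Hypothesis f_inj : forall i s, injective (app (f i) s).
Hypothesis f_ind : forall s,
  independent_on [set: I] (fun i => stalk_image (f i) (s := s)).

Definition sum_images : stalk_set X :=
  fun s => sum_on [set: I] (fun i => stalk_image (f i) (s := s)).

Lemma sum_images_subobject : subobject sum_images.
Proof.
exact: (sum_on_subobject _ (fun i => stalk_image_subobject (f i))).
Qed.

Section SumRelation.
Variables (Y : Mod) (G : forall i, relation (F i) Y).
Arguments G : clear implicits.
Hypothesis lG : forall i, linear_relation (G i).
Hypothesis fG : forall i, functional (G i).

(** Viewing a relation as a subspace of the product lets the partial maps on the summands be added
    by [sum_on]. *)
Definition summand_rel s i (p : stalk X s * stalk Y s) :=
  exists u, app (f i) s u = p.1 /\ G i s u p.2.

Fact summand_rel_subspace s i : subspace (@summand_rel s i).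
Proof.
split=> [|c p q [u [up Gp]] [v [vq Gq]]].
  by exists 0; rewrite linear0; split=> //; apply: (lrel0 (lG i)).
exists (c *: u + v); rewrite linearP up vq; split=> //.
exact: (lrelP (lG i)).
Qed.

Definition sum_rel : relation X Y :=
  fun s x y => sum_on [set: I] (@summand_rel s) (x, y).

Lemma sum_rel_linear : linear_relation sum_rel.
Proof.
split=> [s|s c x y x' y' R1 R2|s t x y st].
- exact: sum_on0.
- by have [_ SP] := sum_on_subspace [set: I] (@summand_rel_subspace s);
    apply: SP c _ _ R1 R2.
- suff push_pair p : sum_on [set: I] (@summand_rel s) p ->
      sum_on [set: I] (@summand_rel t) (push X s t p.1, push Y s t p.2).
    exact: push_pair.
  elim=> [|i q q' _ [u [uq Gq]] _ IH].
    rewrite !linear0; exact: sum_on0.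
  rewrite /= !linearD.
  apply: (sum_onD (i := i) (u := (_, _)) (v := (_, _))) IH => //.
  exists (push (F i) s t u); rewrite app_push uq; split=> //.
  exact: (lrel_push (lG i)).
Qed.

(** Independence kills each first component, injectivity of [f i] carries this back to [F i], and
    single-valuedness of [G i] kills the second components. *)
Lemma sum_rel_functional : functional sum_rel.
Proof.
move=> s y /(sum_onP (@summand_rel_subspace s))[r [a [r_uniq aP sum_a]]].
have /esym sum1 := congr1 fst sum_a; rewrite (raddf_sum fst) /= in sum1.
have /= -> := congr1 snd sum_a; rewrite (raddf_sum snd) /=.
apply: big1_seq => i /= ir; have [_ [u [fu Gu]]] := aP i ir.
suff u0 : u = 0 by apply: (fG (i := i)); rewrite -u0.
apply: (@f_inj i s); rewrite linear0 fu.
apply: (f_ind (r := r) (a := fun i => (a i).1)) => // j jr.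
by have [_ [v [fv _]]] := aP j jr; split=> //; exists v.
Qed.

Lemma sum_rel_mem i s u y : G i s u y -> sum_rel (app (f i) s u) y.
Proof. by move=> Guy; apply: (sum_on_mem (i := i)) => //; exists u. Qed.
End SumRelation.

Local Notation sum_obj := (sub_obj sum_images_subobject).
Local Notation sum_incl := (sub_incl sum_images_subobject).

Lemma sum_images_coproduct : exists inj : forall i, mor (F i) sum_obj,
  is_coproduct inj /\ forall i s u,
    app sum_incl s (app (inj i) s u) = app (f i) s u.
Proof.
have /(_ _)/cid injP i : exists h : mor (F i) sum_obj,
    forall s u, app sum_incl s (app h s u) = app (f i) s u.
  by apply: lift_sub => s u; apply: (sum_on_mem (i := i)) => //; exists u.
pose inj i := sval (injP i); exists inj.
have injE i s u :
    app sum_incl s (app (inj i) s u) = app (f i) s u.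
  by rewrite /inj; case: (injP i).
split=> // Y g.
pose G i : relation (F i) Y := fun s u y => app (g i) s u = y.
have lG i : linear_relation (G i).
  split=> [s|s c u y v z <- <-|s t u y st <-]; rewrite /G.
  - exact: linear0.
  - exact: linearP.
  - exact: app_push.
have fG i : functional (G i) by move=> s y <-; apply: linear0.
have lR := sum_rel_linear lG; have fR := sum_rel_functional lG fG.
pose R : relation sum_obj Y :=
  fun s z y => sum_rel G (app sum_incl s z) y.
(* Any solution of the universal problem has its graph inside the single-valued [R], whence
   uniqueness. *)
have RP (h : mor sum_obj Y) :
    (forall i, heq (compm h (inj i)) (g i)) -> forall s z, R s z (app h s z).
  move=> hg s z; suff RPx x : sum_images x ->
      forall z, app sum_incl s z = x ->
        sum_rel G x (app h s z) by apply: RPx erefl; apply: sub_incl_in.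
  elim=> {z} [|i _ x' _ [u <-] Sx' IH] z zx.
    rewrite (_ : z = 0) ?linear0; first exact: (lrel0 lR).
    by apply: sub_incl_inj; rewrite linear0.
  have [z' z'x] := sub_incl_onto sum_images_subobject Sx'.
  have -> : z = app (inj i) s u + z'.
    by apply: sub_incl_inj; rewrite zx [RHS]linearD injE z'x.
  rewrite linearD -[app (f i) s u]scale1r -[app h s (app _ _ _)]scale1r.
  apply: (lrelP lR); last exact: IH.
  by apply: sum_rel_mem; rewrite /G -(heqE (hg i)).
have [|||h hP] := @functional_mor _ _ _ _ _ R.
- split=> [s|s c z y z' y' R1 R2|s t z y st R1]; rewrite /R.
  + by rewrite linear0; apply: (lrel0 lR).
  + by rewrite linearP; apply: (lrelP lR).
  + by rewrite app_push; apply: (lrel_push lR).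
- by move=> s y; rewrite /R linear0; apply: fR.
- move=> s z; have := sub_incl_in z; rewrite /R.
  move: (app _ s z) => x; elim=> [|i _ x' _ [u <-] _ [y Rxy]].
    by exists 0; apply: (lrel0 lR).
  exists (app (g i) s u + y); rewrite -[app (f i) s u]scale1r.
  rewrite -[app (g i) s u]scale1r; apply: (lrelP lR) => //.
  exact: sum_rel_mem.
exists h; split=> [i|h' h'P]; apply: heqI=> s u.
  apply: (functional_inj lR fR (hP _ _)); rewrite injE.
  exact: sum_rel_mem.
by apply: (functional_inj lR fR _ (hP _ _)); apply: RP.
Qed.

(** Once pushed into the sum, [x] has finitely many components, which are pushed into [K] one at a
    time. By independence [x] stays nonzero as long as one component does. *)
Lemma essential_summands (K : stalk_set X) : subobject K ->
  essential sum_images ->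
  (forall i, essential (fun s u => K s (app (f i) s u))) -> essential K.
Proof.
move=> sK essS essK.
have common (q : seq I) t (x : stalk X t) (u : forall i, stalk (F i) t) :
    x <> 0 -> (forall i t', i \in q ->
      push (F i) t t' (u i) <> 0 -> push X t t' x <> 0) ->
    exists t', push X t t' x <> 0 /\
      forall i, i \in q -> K t' (app (f i) t' (push (F i) t t' (u i))).
  move=> x0; elim: q => [|i q IH] ux; first by exists t; rewrite push_id.
  have [j t' jq|t1 [xt1 Kq]] := IH; first by apply: ux; rewrite inE jq orbT.
  have tt1 := push_neq0_le xt1.
  (* A component that has died is already in [K]; a live one is pushed on to [t2], where being
     nonzero it keeps [x] nonzero. *)
  have [ut1|ut1] := pselect (push (F i) t t1 (u i) = 0).
    exists t1; split=> // j; rewrite inE => /predU1P[->|/Kq//].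
    by rewrite ut1 linear0; apply: sub0.
  have [t2 [ut2 Kt2]] := essK i _ _ ut1; have t12 := push_neq0_le ut2.
  move: ut2 Kt2; rewrite push_comp // => ut2 Kt2.
  exists t2; split; first by apply: ux ut2; apply: mem_head.
  move=> j; rewrite inE => /predU1P[->//|/Kq Kj].
  by rewrite -(push_comp _ tt1 t12) app_push; apply: (sub_push sK).
move=> s x /essS[t [xt0 Sx]]; have st := push_neq0_le xt0.
have [|r [a [r_uniq aP sum_a]]] := sum_onP _ Sx.
  by move=> i; apply: (sub_space (stalk_image_subobject (f i))).
have /(_ _)/cid uP i : exists u, i \in r -> app (f i) t u = a i.
  have [/aP[_ [u <-]]|_] := boolP (i \in r); first by exists u.
  by exists 0.
pose u i := sval (uP i).
have fu i : i \in r -> app (f i) t (u i) = a i by rewrite /u; case: (uP i).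
have pushE t' : push X t t' (push X s t x) =
    \sum_(i <- r) app (f i) t' (push (F i) t t' (u i)).
  rewrite sum_a linear_sum; apply: eq_big_seq => i ir.
  by rewrite app_push fu.
have [i t' ir ut'|t' [xt' Kt']] := common r t _ u xt0.
  rewrite pushE => sum0; apply/ut'/(@f_inj i t'); rewrite linear0.
  pose a' i := app (f i) t' (push (F i) t t' (u i)).
  apply: (f_ind (r := r) (a := a')) => //.
  by move=> j _; split=> //; exists (push (F j) t t' (u j)).
have tt' := push_neq0_le xt'.
exists t'; rewrite -(push_comp x st tt'); split=> //; rewrite pushE.
rewrite big_seq; elim/big_ind: _ => [|y z|i ir].
- exact: sub0.
- exact: (subspaceD (sub_space sK t')).
- exact: Kt'.
Qed.

End FamilyOfSubobjects.

(** * The spectral category *)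

Section Spectral.
Variables (k : fieldType) (d : Order.disp_t) (T : orderType d).
Local Notation Mod := (Mod k T).
Local Notation hom := (loc_mor (@is_essential_mono Mod)).
Local Notation "f =~ g" := (loc_heq f g) (at level 70).
Implicit Types (X Y Z : Mod) (s t : T).

(* The morphisms [X -> Y] of the spectral category are represented by linear
   partial maps with essential domain. *)
Fixpoint graph X Y (phi : hom X Y) : relation X Y :=
  match phi in loc_mor _ X Y return relation X Y with
  | loc_of _ _ f => fun s x y => app f s x = y
  | loc_inv _ _ m _ => fun s x y => app m s y = x
  | loc_comp _ _ _ psi phi =>
      fun s x z => exists y, graph phi x y /\ graph psi y z
  end.

Lemma graph_linear X Y (phi : hom X Y) : linear_relation (graph phi).
Proof.
elim: phi => {X Y} [X Y f|X Y m Wm|X Y Z psi lpsi phi lphi].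
- split=> [s|s c x _ x' _ <- <-|s t x _ st <-] /=.
  + exact: linear0.
  + exact: linearP.
  + exact: app_push.
- split=> [s|s c _ y _ y' <- <-|s t _ y st <-] /=.
  + exact: linear0.
  + exact: linearP.
  + exact: app_push.
- split=> [s|s c x z x' z' [y [xy yz]] [y' [xy' yz']]|s t x z st [y [xy yz]]].
  + by exists 0; split; [apply: (lrel0 lphi)|apply: (lrel0 lpsi)].
  + by exists (c *: y + y'); split; [apply: (lrelP lphi)|apply: (lrelP lpsi)].
  + exists (push Y s t y).
    by split; [apply: (lrel_push lphi)|apply: (lrel_push lpsi)].
Qed.

Lemma graph_functional X Y (phi : hom X Y) : functional (graph phi).
Proof.
elim: phi => {X Y} [X Y f|X Y m Wm|X Y Z psi fpsi phi fphi] s z /=.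
- by move=> <-; rewrite linear0.
- rewrite -(linear0 (app m s)) => /(@is_mono_inj _ _ _ _ _ m); apply.
  by case: Wm.
- by case=> y [/fphi -> /fpsi].
Qed.

(** A zero value is already in [N]. A nonzero one is pushed until it is nonzero in [N], and [x] is
    nonzero there because [R] is single-valued. *)
Lemma essential_preim_relation X Y (R : relation X Y) (N : stalk_set Y) :
  linear_relation R -> functional R ->
  essential (fun s x => exists y, R s x y) -> subobject N -> essential N ->
  essential (fun s x => exists y, R s x y /\ N s y).
Proof.
move=> lR fR eR sN eN s x x0; have [t [xt0 [y Ry]]] := eR s x x0.
have st := push_neq0_le xt0.
have [y0|/eN[u [yu0 Nu]]] := pselect (y = 0).
  exists t; split=> //; exists 0; rewrite -{1}y0; split=> //; exact: sub0.
have tu := push_neq0_le yu0; have Ru := lrel_push lR tu Ry.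
move: Ru; rewrite push_comp // => Ru.
exists u; split; last by exists (push Y t u y).
by move=> xu0; apply/yu0/(fR u); rewrite -xu0.
Qed.

Lemma dom_subobject X Y (R : relation X Y) :
  linear_relation R -> subobject (fun s x => exists y, R s x y).
Proof.
move=> lR; split=> [s|s t x st [y Ry]].
  split=> [|c x x' [y Ry] [y' Ry']]; first by exists 0; apply: (lrel0 lR).
  by exists (c *: y + y'); apply: (lrelP lR).
by exists (push Y s t y); apply: (lrel_push lR).
Qed.

Definition agreement X Y (phi psi : hom X Y) : relation X Y :=
  fun s x y => graph phi x y /\ graph psi x y.

Definition agree X Y (phi psi : hom X Y) :=
  essential (fun s x => exists y, agreement phi psi (s := s) x y).

Lemma agreement_linear X Y (phi psi : hom X Y) :
  linear_relation (agreement phi psi).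
Proof.
have lphi := graph_linear phi; have lpsi := graph_linear psi.
split=> [s|s c x y x' y' [R1 R2] [R1' R2']|s t x y st [R1 R2]].
- by split; [apply: (lrel0 lphi)|apply: (lrel0 lpsi)].
- by split; [apply: (lrelP lphi)|apply: (lrelP lpsi)].
- by split; [apply: (lrel_push lphi)|apply: (lrel_push lpsi)].
Qed.

Lemma agreement_functional X Y (phi psi : hom X Y) :
  functional (agreement phi psi).
Proof. by move=> s y [/graph_functional]. Qed.

Lemma essential_graph X Y (phi : hom X Y) :
  essential (fun s x => exists y, graph phi (s := s) x y).
Proof.
elim: phi => {X Y} [X Y f|X Y m Wm|X Y Z psi epsi phi ephi].
- move=> s x x0; exists s; rewrite push_id; split=> //.
  by exists (app f s x).
- exact: essential_mono_image.
- have := essential_preim_relation (graph_linear phi)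
    (@graph_functional _ _ phi) ephi (dom_subobject (graph_linear psi)) epsi.
  by apply: essentialS => s x [y [xy [z yz]]]; exists z, y.
Qed.

Lemma essentialI X (N N' : stalk_set X) : subobject N -> essential N ->
  essential N' -> essential (fun s x => N s x /\ N' s x).
Proof.
move=> sN eN eN' s x /eN[t [xt0 Nt]]; have [u [xu0 Nu]] := eN' _ _ xt0.
have tu := push_neq0_le xu0.
move: (sub_push sN tu Nt) xu0 Nu; rewrite push_comp ?(push_neq0_le xt0) //.
by exists u.
Qed.

Lemma agreeS X Y (phi psi : hom X Y) (R : relation X Y) :
  essential (fun s x => exists y, R s x y) ->
  (forall s x y, R s x y -> graph phi x y) ->
  (forall s x y, R s x y -> graph psi x y) -> agree phi psi.
Proof.
by move=> eR Rphi Rpsi; apply: essentialS eR => s x [y Ry]; exists y;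
  split; [apply: Rphi|apply: Rpsi].
Qed.

(** Transitivity intersects two essential subobjects, and congruence of composition takes the
    preimage of one under a partial map. *)
Lemma loc_heq_agree X Y (phi psi : hom X Y) : phi =~ psi -> agree phi psi.
Proof.
elim=> {X Y phi psi}
  [X Y f|X Y f g _|X Y f g h _ fg _ gh|X Y Z g g' f f' _ gg' _ ff'
  |X Y f|X Y f|X Y Z W h g f|X Y f g fg|X Y Z g f|X Y m Wm|X Y m Wm].
- by apply: (agreeS (@essential_graph _ _ f)).
- by apply: essentialS => s x [y [fxy gxy]]; exists y.
- apply: essentialS (essentialI (dom_subobject (agreement_linear f g)) fg gh).
  move=> s x [[y [fxy gxy]] [z [gxz hxz]]]; exists y; split=> //.
  have fg' := @graph_functional _ _ g.
  by rewrite (functional_inj (graph_linear g) fg' gxy gxz).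
- apply: essentialS (essential_preim_relation (agreement_linear f f')
    (@agreement_functional _ _ f f') ff' (dom_subobject (agreement_linear g g'))
    gg') => s x [y [[fxy fxy'] [z [gyz gyz']]]].
  by exists z; split; exists y.
- by apply: (agreeS (@essential_graph _ _ f)) => // s x y fxy; exists y.
- by apply: (agreeS (@essential_graph _ _ f)) => // s x y fxy; exists x.
- apply: (agreeS (@essential_graph _ _ (loc_comp h (loc_comp g f)))) => //.
  by move=> s x w [z [[y [fxy gyz]] hzw]]; exists y; split=> //; exists z.
- apply: (agreeS (@essential_graph _ _ (loc_of _ f))) => // s x y /= <-.
  exact/esym/heqE.
- apply: (agreeS (@essential_graph _ _ (loc_of _ (compm g f)))) => //.
  by move=> s x z /= <-; exists (app f s x).
- apply: (agreeS (@essential_graph _ _ (loc_of _ (idm X)))) => // s x y /= <-.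
  by exists (app m s x).
(* [m] after its formal inverse is defined only on the image of [m], which is essential, and is the
   identity there. *)
- apply: (agreeS (R := fun s y z => z = y /\ stalk_image m (s := s) y)).
  + apply: essentialS (essential_mono_image Wm) => s y im_y.
    by exists y.
  + by move=> s y z [-> [x <-]]; exists x.
  + by move=> s y z [-> _].
Qed.

(** A word whose graph is defined everywhere along [u] can be evaluated there. For a formal inverse,
    [u] factors as [m] after [g]; for a composite, the intermediate values form a genuine morphism
    [v]. *)
Lemma graph_loc_comp X Y (phi : hom X Y) Z (u : mor Z X) (g : mor Z Y) :
  (forall s z, graph phi (app u s z) (app g s z)) ->
  loc_comp phi (loc_of _ u) =~ loc_of _ g.
Proof.
elim: phi Z u g => {X Y} [X Y f|X Y m Wm|X Y W psi IHpsi phi IHphi] Z u g ug.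
- apply: loc_trans (loc_sym (loc_of_comp _ _ _)) (loc_of_heq _ _).
  exact: heqI.
- have mg : heq u (compm m g) by apply: heqI=> s z; symmetry; apply: ug.
  apply: loc_trans (loc_comp_heq (loc_refl _) (loc_of_heq _ mg)) _.
  apply: loc_trans (loc_comp_heq (loc_refl _) (loc_of_comp _ _ _)) _.
  apply: loc_trans (loc_comp_assoc _ _ _) _.
  exact: loc_trans (loc_comp_heq (loc_invl Wm) (loc_refl _)) (loc_comp_idl _).
- pose R : relation Z Y := fun s z y => graph phi (app u s z) y.
  have lphi := graph_linear phi.
  have [|||v vP] := @functional_mor _ _ _ _ _ R.
  + split=> [s|s c z y z' y' R1 R2|s t z y st R1]; rewrite /R.
    * by rewrite linear0; apply: (lrel0 lphi).
    * by rewrite linearP; apply: (lrelP lphi).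
    * by rewrite app_push; apply: (lrel_push lphi).
  + by move=> s y; rewrite /R linear0; apply: graph_functional.
  + by move=> s z; have [y [uy _]] := ug s z; exists y.
  apply: loc_trans (loc_sym (loc_comp_assoc _ _ _)) _.
  apply: loc_trans (loc_comp_heq (loc_refl _) (IHphi _ _ _ vP)) (IHpsi _ _ _ _).
  move=> s z; have [y [uy yg]] := ug s z.
  by rewrite -(functional_inj lphi (@graph_functional _ _ phi) uy (vP s z)).
Qed.

(** The domain of [R] is the apex of a roof [X <- Z -> Y] whose left leg becomes invertible in the
    localisation. *)
Lemma restriction X Y (R : relation X Y) : linear_relation R -> functional R ->
  essential (fun s x => exists y, R s x y) ->
  exists Z (i : mor Z X) (g : mor Z Y),
    [/\ is_essential_mono i, forall s z, R s (app i s z) (app g s z) &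
        forall s x y, R s x y -> exists z, app i s z = x].
Proof.
move=> lR fR eR; have sD := dom_subobject lR.
pose R' : relation (sub_obj sD) Y := fun s z y => R s (app (sub_incl sD) s z) y.
have [|||g gP] := @functional_mor _ _ _ _ _ R'.
- split=> [s|s c z y z' y' R1 R2|s t z y st R1]; rewrite /R'.
  + by rewrite linear0; apply: (lrel0 lR).
  + by rewrite linearP; apply: (lrelP lR).
  + by rewrite app_push; apply: (lrel_push lR).
- by move=> s y; rewrite /R' linear0; apply: fR.
- by move=> s z; apply: (sub_incl_in z).
exists (sub_obj sD), (sub_incl sD), g; split=> // [|s x y Rxy].
  apply: essential_mono; first exact: sub_incl_inj.
  by apply: essentialS eR => s x Dx; apply: (sub_incl_onto sD).
by apply: (sub_incl_onto sD); exists y.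
Qed.

(** Both words restrict to the same [g] along the inclusion [i] of the subobject where they agree,
    so both equal [g] after the formal inverse of [i]. *)
Lemma agree_loc_heq X Y (phi psi : hom X Y) : agree phi psi -> phi =~ psi.
Proof.
move=> e; have [Z [i [g [ei ig _]]]] :=
  restriction (agreement_linear phi psi) (@agreement_functional _ _ phi psi) e.
have cancel chi : (forall s z, graph chi (app i s z) (app g s z)) ->
    chi =~ loc_comp (loc_of _ g) (loc_inv ei).
  move=> chiP.
  apply: loc_trans (loc_sym (loc_comp_idr _)) _.
  apply: loc_trans (loc_comp_heq (loc_refl _) (loc_sym (loc_invr ei))) _.
  apply: loc_trans (loc_comp_assoc _ _ _) (loc_comp_heq _ (loc_refl _)).
  exact: graph_loc_comp.
by apply: loc_trans (cancel _ _) (loc_sym (cancel _ _)) => s z;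
  case: (ig s z).
Qed.

Lemma realize X Y (R : relation X Y) : linear_relation R -> functional R ->
  essential (fun s x => exists y, R s x y) ->
  exists phi : hom X Y, forall s x y, R s x y -> graph phi x y.
Proof.
move=> lR fR eR; have [Z [i [g [ei ig onto]]]] := restriction lR fR eR.
exists (loc_comp (loc_of _ g) (loc_inv ei)) => s x y Rxy.
have [z zx] := onto _ _ _ Rxy; exists z; split=> //=.
by apply: (functional_inj lR fR (ig s z)); rewrite zx.
Qed.

End Spectral.

(** * Zero objects, simple objects and coproducts in the spectral category *)

Section SpectralObjects.
Variables (k : fieldType) (d : Order.disp_t) (T : orderType d).
Local Notation Mod := (Mod k T).
Local Notation Spec := (spectral_category Mod).
Local Notation hom := (loc_mor (@is_essential_mono Mod)).
Implicit Types (X Y Z : Mod) (s t : T).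

Lemma spectral_zero_trivial X : is_zero (X : Spec) -> trivial X.
Proof.
case=> /(_ X)[z zP] _ s x; apply: contrapT => x0.
have id0 : @heq Spec X X (loc_of _ (idm X)) (loc_of _ (zero_mor X X)).
  exact: loc_trans (zP _) (loc_sym (zP _)).
have [t [xt0 [y [idx zx]]]] := loc_heq_agree id0 x0.
by apply: xt0; apply: etrans idx (esym zx).
Qed.

Lemma trivial_spectral_zero X : trivial X -> is_zero (X : Spec).
Proof.
move=> X0; split=> Y.
  exists (loc_of _ (zero_mor X Y)) => g; apply: agree_loc_heq => s x.
  by rewrite (X0 s x).
exists (loc_of _ (zero_mor Y X)) => g; apply: agree_loc_heq.
apply: (agreeS (@essential_graph _ _ _ _ _ g)) => // s y x _ /=.
by rewrite (X0 s x).
Qed.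

(** The kernel test in the localisation: the inclusion of the kernel of [graph m] agrees with zero
    on an essential subobject, which forces the kernel to vanish. *)
Lemma spectral_mono_functional Y X (m : hom Y X) :
  @is_mono Spec Y X m -> functional (fun s x y => graph m (s := s) y x).
Proof.
move=> mono_m s y my0.
have sK : subobject (fun s y => graph m (s := s) y 0).
  have lm := graph_linear m.
  split=> [t|t u z tu mz]; last by have := lrel_push lm tu mz; rewrite linear0.
  split=> [|c z z' mz mz']; first exact: (lrel0 lm).
  by have := lrelP lm c mz mz'; rewrite scaler0 addr0.
pose i : hom (sub_obj sK) Y := loc_of _ (sub_incl sK).
pose z : hom (sub_obj sK) Y := loc_of _ (zero_mor (sub_obj sK) Y).
have /loc_heq_agree iz : loc_heq i z.
  apply: mono_m; apply: (@loc_trans _ _ _ _ _ (loc_of _ (zero_mor _ X))).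
    by apply: graph_loc_comp => t w; apply: (sub_incl_in w).
  by apply/loc_sym/graph_loc_comp => t w; apply: (lrel0 (graph_linear m)).
have [w wy] := sub_incl_onto sK my0; rewrite -wy; apply: contrapT => iw0.
have w0 : w <> 0 by move=> w0; apply: iw0; rewrite w0 linear0.
have [t [wt0 [v [iv zv]]]] := iz s w w0.
apply/wt0/(@sub_incl_inj _ _ _ _ _ sK t); rewrite linear0.
exact: etrans iv (esym zv).
Qed.

(** The inverse of a nonzero [m] is its converse relation, single-valued as [m] is a monomorphism;
    its domain is a nonzero subobject of [X], hence essential. *)
Lemma uniform_spectral_simple X : uniform X -> is_simple (X : Spec).
Proof.
case=> ntX uX; split=> [/spectral_zero_trivial//|Y m mono_m].
have [/trivial_spectral_zero|/nontrivial[s [y y0]]] :=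
  pselect (trivial (Y : Mod)).
  by left.
right; have lm := graph_linear m.
pose R : relation X Y := fun s x y => graph m y x.
have lR : linear_relation R.
  split=> [t|t c z x z' x'|t u z x tu]; rewrite /R.
  - exact: (lrel0 lm).
  - exact: (lrelP lm).
  - exact: (lrel_push lm).
have fR := spectral_mono_functional mono_m.
have [t [yt0 [x mx]]] := essential_graph m y0.
have eR : essential (fun s x => exists y, R s x y).
  apply: uX; first exact: dom_subobject.
  exists t, x; split; first by exists (push Y s t y).
  by move=> x0; apply: yt0; apply: (fR t); rewrite -x0.
have [phi phiP] := realize lR fR eR.
exists phi; split; apply: agree_loc_heq.
  apply: (agreeS (R := fun s y y' => y = y' /\ exists x, graph m (s := s) y x)).
  - apply: essentialS (essential_graph m) => u z [z' zz'].
    by exists z; split=> //; exists z'.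
  - by move=> u z _ [<- [z' zz']]; exists z'; split=> //; apply: phiP.
  - by move=> u z _ [<- _].
apply: (agreeS (R := fun s x x' => x = x' /\ exists y, R s x y)).
- by apply: essentialS eR => u z [z' zz']; exists z; split=> //; exists z'.
- by move=> u z _ [<- [z' zz']]; exists z'; split=> //; apply: phiP.
- by move=> u z _ [<- _].
Qed.

(** The graphs of the given morphisms add up to a partial map. Its domain, and for uniqueness the
    subobject where two solutions agree, is essential on each summand, so [essential_summands]
    applies. *)
Lemma spectral_coproduct X (I : choiceType) (F : I -> Mod)
    (f : forall i, mor (F i) X) :
  (forall i s, injective (app (f i) s)) ->
  (forall s, independent_on [set: I]%classic
     (fun i => stalk_image (f i) (s := s))) ->
  essential (sum_images f) ->
  @is_coproduct Spec I F X (fun i => loc_of _ (f i)).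
Proof.
move=> f_inj f_ind f_ess Y phi.
pose G i : relation (F i) Y := graph (phi i : hom (F i) Y).
have lG i : linear_relation (G i) := graph_linear _.
have fG i : functional (G i) := @graph_functional _ _ _ _ _ (phi i).
have lR := sum_rel_linear f lG.
have fR := sum_rel_functional f_inj f_ind lG fG.
have [|h hP] := realize lR fR.
  apply: (essential_summands f_inj f_ind) f_ess _ => [|i].
    exact: dom_subobject.
  apply: essentialS (essential_graph (phi i)) => s u [y uy].
  by exists y; apply: sum_rel_mem.
exists h; split=> [i|h' h'P]; apply: agree_loc_heq.
  apply: (agreeS (@essential_graph _ _ _ _ _ (phi i))) => // s u y uy.
  by exists (app (f i) s u); split=> //; apply/hP/sum_rel_mem.
have sD := dom_subobject (agreement_linear h' h).
apply: (essential_summands f_inj f_ind sD f_ess) => i.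
have eh' := loc_heq_agree (h'P i).
apply: essentialS eh' => s u [y [[x [<- h'xy]] uy]].
by exists y; split=> //; apply/hP/sum_rel_mem.
Qed.

(** Turns the maximal independent set of nonzero elements into a type of indices, as coproducts
    require; coefficients on that subtype are extended by zero. *)
Lemma independent_family X (F : {t : T & stalk X t} -> Mod)
    (f : forall p, mor (F p) X) :
  (forall p : {t : T & stalk X t}, tagged p <> 0 -> [/\ uniform (F p),
     forall s, injective (app (f p) s) & stalk_image (f p) (tagged p)]) ->
  exists (I : choiceType) (c : I -> {t : T & stalk X t}),
    [/\ forall i, tagged (c i) <> 0,
        forall s, independent_on [set: I]%classic
          (fun i => stalk_image (f (c i)) (s := s)) &
        essential (sum_images (fun i => f (c i)))].
Proof.
move=> fP; pose N (p : {t : T & stalk X t}) : stalk_set X := stalk_image (f p).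
have [|p p0|p K s _ sK p0 [v <-] Kv v0|P [P0 indP essP]] :=
    @maximal_independent _ _ _ X N.
- by move=> p; apply: stalk_image_subobject.
- by have [] := fP p p0.
- have [uF f_inj [u fu]] := fP p p0; rewrite -fu.
  apply: uniform_meet Kv => //.
    by move=> u0; apply: p0; rewrite -fu u0 linear0.
  by move=> v00; apply: v0; rewrite v00 linear0.
pose I : choiceType := {p : {t : T & stalk X t} | `[<P p>]}.
exists I, val; split=> [[p /asboolP/P0//]|s r a r_uniq aP sum0 i ir|].
  pose a' p := if insub p is Some i then a (i : I) else 0.
  have a'E j : a' (val j) = a j by rewrite /a' valK.
  rewrite -a'E; apply: (indP s (map val r) a').
  - by rewrite (map_inj_uniq val_inj).
  - move=> _ /mapP[j jr ->]; split; first by case: j {jr} => p /= /asboolP.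
    by rewrite a'E; case: (aP j jr).
  - by rewrite big_map -[RHS]sum0; apply: eq_bigr.
  - exact: map_f.
apply: essentialS essP => s x; elim=> [|p u v Pp Nu _ IH]; first exact: sum_on0.
have Pp' : `[<P p>] by apply/asboolP.
exact: (sum_onD (i := exist _ p Pp' : I)).
Qed.

(** * The subobject generated by an element, and its hull *)

Section Cyclic.
Variables (X : Mod) (t : T) (x : stalk X t).
Hypothesis x0 : x <> 0.

Definition supp : pred T := fun s => `[<push X t s x <> 0>].

Lemma suppP s : reflect (push X t s x <> 0) (supp s).
Proof. exact: asboolP. Qed.

Lemma supp_t : supp t.
Proof. by apply/suppP; rewrite push_id. Qed.

Lemma supp_le s : supp s -> (t <= s)%O.
Proof. by move=> /suppP/push_neq0_le. Qed.

Lemma supp_down s u : (t <= s)%O -> (s <= u)%O -> supp u -> supp s.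
Proof.
move=> ts su /suppP xu0; apply/suppP => xs0; apply: xu0.
by rewrite -(push_comp x ts su) xs0 linear0.
Qed.

Lemma supp_convex : convex supp.
Proof.
by move=> s u v su uv /supp_le ts; apply: supp_down (le_trans ts su) uv.
Qed.

Local Notation cyclic_obj := (interval_obj k supp_convex).

Fact cyclic_push s u : (s <= u)%O -> supp s -> supp u ->
  push X s u (push X t s x) = push X t u x.
Proof. by move=> su /supp_le ts _; rewrite push_comp. Qed.

Fact cyclic_out s u : (s <= u)%O -> supp s -> ~~ supp u ->
  push X s u (push X t s x) = 0.
Proof.
by move=> su /supp_le ts /suppP/contrapT; rewrite push_comp.
Qed.

Definition cyclic_mor : mor cyclic_obj X :=
  interval_mor supp_convex cyclic_push cyclic_out.

Lemma cyclic_mor_inj s : injective (app cyclic_mor s).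
Proof.
apply: app_inj => v; have /orP[Ds|nDs] := orbN (supp s); last first.
  by move=> _; apply: interval_out.
have [a ->] := interval_span v.
rewrite linearZ_LR app_interval_mor // => /eqP; rewrite scaler_eq0.
by case/orP=> [/eqP ->|/eqP xs0]; [rewrite scale0r|case/suppP: Ds].
Qed.

Lemma cyclic_mor_image : stalk_image cyclic_mor x.
Proof.
exists (interval_one k supp_convex t).
by rewrite app_interval_mor ?push_id // supp_t.
Qed.

Lemma cyclic_uniform : uniform cyclic_obj.
Proof. by apply: interval_uniform; exists t; apply: supp_t. Qed.

Definition hull : pred T := fun s => (s <= t)%O || supp s.

Lemma hull_down s u : (s <= u)%O -> hull u -> hull s.
Proof.
rewrite /hull => su /orP[ut|Du]; first by rewrite (le_trans su ut).
by have /orP[->//|ts] := le_total s t; rewrite (supp_down ts su Du) orbT.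
Qed.

Local Notation hull_obj := (interval_obj k (down_set_convex hull_down)).

(** The extension over the hull stays injective: a nonzero element at an index below [t] pushes to a
    nonzero multiple of the generator at [t], which is sent to [x]. *)
Lemma cyclic_embedding : is_injective X ->
  exists f : mor hull_obj X,
    (forall s, injective (app f s)) /\ stalk_image f x.
Proof.
move=> injX; pose e s := interval_one k (down_set_convex hull_down) s.
have supp_hull s : supp s -> hull s by rewrite /hull orbC => ->.
have e_push s u : (s <= u)%O -> supp s -> supp u ->
    push hull_obj s u (e s) = e u.
  by move=> su /supp_hull Ds _; apply: push_interval_one.
(* Leaving the support upwards means leaving the hull: otherwise [u] would be at most [t] and at
   least [t], hence equal to [t], which is in the support. *)
have e_out s u : (s <= u)%O -> supp s -> ~~ supp u ->
    push hull_obj s u (e s) = 0.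
  move=> su Ds nDu; apply: interval_out; apply: contra nDu => /orP[ut|//].
  have -> : u = t by apply/le_anti; rewrite ut (le_trans (supp_le Ds) su).
  exact: supp_t.
pose m := interval_mor supp_convex e_push e_out.
have mE s : supp s -> app m s (interval_one k supp_convex s) = e s.
  exact: app_interval_mor.
have [|f /heqE fm] := injX _ _ m cyclic_mor.
  apply: inj_is_mono => s; apply: app_inj => v.
  have /orP[Ds|nDs] := orbN (supp s); last by move=> _; apply: interval_out.
  have [a ->] := interval_span v; rewrite linearZ_LR mE // => /eqP.
  rewrite scaler_eq0 => /orP[/eqP ->|/eqP]; first by rewrite scale0r.
  by move/interval_one_neq0; case; apply: supp_hull.
have fE s : supp s -> app f s (e s) = push X t s x.
  by move=> Ds; rewrite -mE // -app_comp fm app_interval_mor.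
have ft : app f t (e t) = x by rewrite fE ?supp_t // push_id.
have fe0 s : hull s -> app f s (e s) <> 0.
  move=> hs fs0; case/orP: (hs) => [st|Ds].
    apply: x0; rewrite -[LHS]ft.
    have <- : push hull_obj s t (e s) = e t by apply: push_interval_one.
    by rewrite app_push fs0 linear0.
  by case/suppP: (Ds); rewrite -fE.
exists f; split=> [s|]; last by exists (e t).
apply: app_inj => v; have /orP[Ds|nDs] := orbN (hull s); last first.
  by move=> _; apply: interval_out.
have [a ->] := interval_span v; rewrite linearZ_LR => /eqP.
rewrite scaler_eq0 => /orP[/eqP ->|/eqP /(fe0 s Ds)//].
by rewrite scale0r.
Qed.

Lemma hull_injective_uniform :
  is_injective (hull_obj : Mod) /\ uniform hull_obj.
Proof.
split; first exact: interval_injective hull_down.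
by apply: interval_uniform; exists t; rewrite /hull lexx.
Qed.
End Cyclic.
End SpectralObjects.

(** Both halves apply [independent_family]: with hulls inside an injective [E], and with the
    generated modules themselves inside an arbitrary [X], where hulls need not embed. *)
Theorem corollary4p6 (k : fieldType) (d : Order.disp_t) (T : orderType d) :
  (forall E : Mod k T, is_injective E ->
     exists (I : Type) (F : I -> Mod k T) (S : Mod k T)
            (inj : forall i : I, mor (F i) S)
            (E' : Mod k T) (m : mor S E'),
       (forall i : I, is_injective (F i) /\ is_indecomposable (F i)) /\
       is_coproduct inj /\
       is_injective_envelope m /\
       isomorphic E E') /\
  is_discrete (spectral_category (Mod k T)).
Proof.
split=> [E injE|X].
  pose sub (p : {t : T & stalk E t}) := {Y : Mod k T & mor Y E}.
  have /(_ _)/cid FP p : exists Ff : sub p, tagged p <> 0 ->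
      [/\ is_injective (tag Ff), uniform (tag Ff),
        forall s, injective (app (tagged Ff) s) &
        stalk_image (tagged Ff) (tagged p)].
    have [p0|p0] := pselect (tagged p = 0).
      (* A placeholder: the specification constrains nonzero elements only. *)
      by exists (existT (fun Y : Mod k T => mor Y E) E (idm E)).
    have [f [f_inj f_im]] := cyclic_embedding p0 injE.
    have [injF uF] := hull_injective_uniform (tagged p).
    by exists (existT (fun Y : Mod k T => mor Y E) _ f).
  pose F p := tag (sval (FP p)); pose f p : mor (F p) E := tagged (sval (FP p)).
  have fP (p : {t : T & stalk E t}) : tagged p <> 0 ->
      [/\ is_injective (F p), uniform (F p),
        forall s, injective (app (f p) s) & stalk_image (f p) (tagged p)].
    by rewrite /F /f; case: (FP p).
  have [p /fP[] //|I [c [c0 c_ind c_ess]]] := @independent_family _ _ _ E F f.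
  have f_inj i s : injective (app (f (c i)) s) by have [] := fP _ (c0 i).
  have [inj [cop _]] := sum_images_coproduct f_inj c_ind.
  (* The coproduct is realised as an essential subobject of [E], so [E] itself serves as its
     envelope. *)
  exists I, (fun i => F (c i)), _, inj, E, (sub_incl _); split.
    move=> i; have [? ? _ _] := fP _ (c0 i).
    by split=> //; apply: uniform_indecomposable.
  split=> //; split.
    split=> //; apply: essential_mono; first exact: sub_incl_inj.
    by apply: essentialS c_ess => s x; apply: sub_incl_onto.
  by exists (idm E), (idm E); split; apply: compm_idl.
pose X' : Mod k T := X; pose point := {t : T & stalk X' t}.
pose supp_conv (p : point) := supp_convex (x := tagged p).
pose f p : mor (interval_obj k (supp_conv p)) X' := cyclic_mor (tagged p).
have [p p0|I [c [c0 c_ind c_ess]]] := @independent_family _ _ _ X' _ f.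
  split; [exact: cyclic_uniform|exact: cyclic_mor_inj|exact: cyclic_mor_image].
exists I, (fun i => interval_obj k (supp_conv (c i))).
exists (fun i => loc_of _ (f (c i))); split.
  by move=> i; apply/uniform_spectral_simple/cyclic_uniform.
by apply: spectral_coproduct => // i; apply: cyclic_mor_inj.
Qed.
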